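(* Let $R$ be a one-dimensional analytically irreducible residually rational ring whose maximal ideal has the form $\mathfrak{m}=(t^{n_1},\ldots,t^{n_e})$ for some $t\in\overline{R}$, and let $R'$ be a $\mathbb{Z}^n$ standard graded $k$-subalgebra of $k[x_1,\ldots,x_n]$. Let $I$ and $J$ be monomial fractional ideals of $R$. Let $I'$ and $J'$ be finitely generated monomial fractional ideals of $R'$. Then $$\lambda_R(\mathrm{T}(I\otimes_R J))=\tau(v(I),v(J))\quad\text{and}\quad \lambda_{R'}(\mathrm{T}(I'\otimes_{R'}J'))=\tau(\deg(I'),\deg(J')).$$
   Context: $\mathrm{T}(M)=\{x\in M: rx=0\text{ for some nonzero }r\in R\}$ is the torsion submodule of a module $M$ over a domain $R$; $\lambda_R$ denotes length as an $R$-module (possibly $\infty$). A fractional ideal is a (nonzero) finitely generated submodule of the field of fractions $K$. Local rings are Noetherian; a local ring is analytically irreducible if its completion is a domain, and an analytically irreducible local ring is residually rational if it has the same residue field as its integral closure. For $R$ one-dimensional, analytically irreducible and residually rational, the integral closure $\overline{R}$ is a discrete valuation ring; $v$ denotes its normalized valuation, and $v(X)=\{v(f): f\in X\setminus\{0\}\}$. Then $v(R)$ is a numerical semigroup. A monomial fractional ideal of $R$ is one of the form $(t^{z_1},\ldots,t^{z_h})$, $z_i\in\mathbb{Z}$. $k$ is a field. A $\mathbb{Z}^n$ standard graded $k$-subalgebra of $k[x_1,\ldots,x_n]$ is a $k$-subalgebra homogeneous for the $\mathbb{Z}^n$-grading in which $x_i$ has degree the $i$-th standard basis vector (i.e. spanned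 over $k$ by the monomials it contains); a monomial fractional ideal of it is one generated by Laurent monomials $x^w$, $w\in\mathbb{Z}^n$, lying in its fraction field. Fix a monomial ordering on $k[x_1,\ldots,x_n]$. For nonzero $f$, $\deg(f)\in\mathbb{N}_0^n$ is the exponent vector of the leading monomial of $f$, $\deg(f/g)=\deg(f)-\deg(g)$, and $\deg(X)=\{\deg(f):f\in X\setminus\{0\}\}$. For a submonoid $S$ of $\mathbb{N}_0^n$, a relative ideal of $S$ is a finite union $\bigcup_{i=1}^h(a_i+S)$ with $a_i\in\mathbb{Z}^n$. For relative ideals $A,B$ of $S$, $A\otimes_S B$ is the set $A\times B$ modulo the equivalence relation generated by $(s+a,b)\sim(a,s+b)$ for $a\in A$, $b\in B$, $s\in S$; the class of $(a,b)$ is $a\otimes b$. Let $\chi:A\otimes_S B\to\mathbb{Z}^n$, $\chi(a\otimes b)=a+b$; put $\tau_z(A,B)=\max\{0,|\chi^{-1}(z)|-1\}$ for $z\in\mathbb{Z}^n$ and $\tau(A,B)=\sum_{z\in\mathbb{Z}^n}\tau_z(A,B)$. Here $\tau(v(I),v(J))$ is formed over $S=v(R)$ and $\tau(\deg(I'),\deg(J'))$ over $S=\deg(R')$. *)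

(* Defs.v *)
From HB Require Import structures.
From Stdlib Require Import Relations.
From mathcomp Require Import all_boot all_order all_algebra.
From mathcomp Require Import monalg.
From mathcomp Require Import mpoly.
From mathcomp Require Import boolp classical_sets functions cardinality reals.
From mathcomp Require Import ereal esum measure.

Set Implicit Arguments.
Unset Strict Implicit.
Unset Printing Implicit Defensive.

Import Order.TTheory GRing.Theory Num.Theory.
Local Open Scope classical_set_scope.
Local Open Scope ring_scope.
Local Open Scope quotient_scope.

Section Span.
Variables (A : comNzRingType) (M : lmodType A).

Definition lspan (X : set M) : {pred M} := fun x =>
  `[< exists n (a : 'I_n -> A) (g : 'I_n -> M),
        (forall i, X (g i)) /\ x = \sum_(i < n) a i *: g i >].

Lemma lspan_subsemimod (X : set M) : GRing.subsemimod_closed (lspan X).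
Proof.
split; [split=> [|x y /asboolP[n [a [g [gX ->]]]] /asboolP[p [b [h [hX ->]]]]] |].
- by apply/asboolP; exists 0%N, (fun=> 0), (fun=> 0); split=> [[]//|]; rewrite big_ord0.
- apply/asboolP; exists (n + p)%N.
  exists (fun i => match fintype.split i with inl i => a i | inr i => b i end).
  exists (fun i => match fintype.split i with inl i => g i | inr i => h i end).
  split=> [i|]; first by case: fintype.split.
  rewrite big_split_ord /=; congr (_ + _); apply: eq_bigr => i _.
    by rewrite -[lshift p i]/(unsplit (inl i)) unsplitK.
  by rewrite -[rshift n i]/(unsplit (inr i)) unsplitK.
- move=> c x /asboolP[n [a [g [gX ->]]]]; apply/asboolP.
  exists n, (fun i => c * a i), g; split=> //.
  by rewrite scaler_sumr; apply: eq_bigr => i _; rewrite scalerA.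
Qed.

HB.instance Definition _ (X : set M) :=
  GRing.isSubmodClosed.Build A M (lspan X) (lspan_subsemimod X).

Lemma mem_lspan (X : set M) x : X x -> x \in lspan X.
Proof.
move=> Xx; apply/asboolP; exists 1%N, (fun=> 1), (fun=> x); split=> //.
by rewrite big_ord1 scale1r.
Qed.

End Span.

Section SubModule.
Variables (A : comNzRingType) (M : lmodType A) (N : submodClosed M).

Definition submod : Type := {x : M | x \in N}.

HB.instance Definition _ := [isSub of submod for sval].
HB.instance Definition _ := [Choice of submod by <:].
HB.instance Definition _ := [SubChoice_isSubLmodule of submod by <:].

End SubModule.

Section QuotientModule.
Variables (A : comNzRingType) (M : lmodType A) (N : submodClosed M).

(* [submodClosed] does not inherit from [zmodClosed] in the library. *)
Definition zmod_of_submod : {pred M} := N.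

Lemma zmod_of_submod_closed : zmod_closed zmod_of_submod.
Proof.
by split=> [|x y Nx Ny]; rewrite /zmod_of_submod ?rpred0 // -scaleN1r rpredD ?rpredZ.
Qed.

HB.instance Definition _ :=
  GRing.isZmodClosed.Build M zmod_of_submod zmod_of_submod_closed.

Definition quotmod : Type := Quotient.quot zmod_of_submod.

HB.instance Definition _ := GRing.Zmodule.on quotmod.

Definition quotmod_pi (x : M) : quotmod := \pi_(Quotient.quot zmod_of_submod) x.
Definition quotmod_scale (a : A) (x : quotmod) : quotmod :=
  quotmod_pi (a *: repr (x : Quotient.quot zmod_of_submod)).

Lemma quotmod_piE x y : (quotmod_pi x = quotmod_pi y) <-> x - y \in N.
Proof.
rewrite -[x - y \in N]/(x - y \in zmod_of_submod) Quotient.idealrBE.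
by split=> [e|/eqP //]; apply/eqP.
Qed.

Lemma quotmod_piK (x : quotmod) : quotmod_pi (repr (x : Quotient.quot zmod_of_submod)) = x.
Proof. exact: reprK. Qed.

Lemma quotmod_piD x y : quotmod_pi (x + y) = quotmod_pi x + quotmod_pi y.
Proof. exact: raddfD. Qed.

Lemma quotmod_piZ a x : quotmod_scale a (quotmod_pi x) = quotmod_pi (a *: x).
Proof.
apply/quotmod_piE; rewrite -scalerBr rpredZ //.
by apply/quotmod_piE; rewrite quotmod_piK.
Qed.

Lemma quotmod_scaleA a b x :
  quotmod_scale a (quotmod_scale b x) = quotmod_scale (a * b) x.
Proof. by rewrite -[x]quotmod_piK !quotmod_piZ scalerA. Qed.
Lemma quotmod_scale1 : left_id 1 quotmod_scale.
Proof. by move=> x; rewrite -[x]quotmod_piK quotmod_piZ scale1r. Qed.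
Lemma quotmod_scaleDr : right_distributive quotmod_scale +%R.
Proof.
move=> a x y; rewrite -[x]quotmod_piK -[y]quotmod_piK -quotmod_piD !quotmod_piZ.
by rewrite scalerDr quotmod_piD.
Qed.
Lemma quotmod_scaleDl x : {morph quotmod_scale^~ x : a b / a + b}.
Proof.
by move=> a b /=; rewrite -[x]quotmod_piK !quotmod_piZ scalerDl quotmod_piD.
Qed.

HB.instance Definition _ := GRing.Zmodule_isLmodule.Build A quotmod
  quotmod_scaleA quotmod_scale1 quotmod_scaleDr quotmod_scaleDl.

End QuotientModule.

Section Tensor.
Variables (A : comNzRingType) (M N : lmodType A).

Definition bilin_rels : set {malg A[(M * N)%type]} :=
  [set r | (exists x x' y, r = << (x + x', y) >> - << (x, y) >> - << (x', y) >>)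
        \/ (exists x y y', r = << (x, y + y') >> - << (x, y) >> - << (x, y') >>)
        \/ (exists a x y, r = << (a *: x, y) >> - a *: << (x, y) >>)
        \/ (exists a x y, r = << (x, a *: y) >> - a *: << (x, y) >>)].

Definition tensor : lmodType A := quotmod (lspan bilin_rels).

Definition tensor_elt (x : M) (y : N) : tensor :=
  quotmod_pi (lspan bilin_rels) << (x, y) >>.

End Tensor.

Definition torsion (A : comNzRingType) (M : lmodType A) : set M :=
  [set x | exists2 r : A, r != 0 & r *: x = 0].

Arguments torsion {A} M.

(* Length of [N], a submodule of [M]. It may be infinite: [F] only serves to form
   the extended numbers [\bar F]. *)
Definition module_length (F : realType) (A : comNzRingType) (M : lmodType A)
    (N : set M) : \bar F :=
  ereal_sup [set n%:R%:E | n in [set n | exists C : nat -> submodClosed M,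
    [/\ [set` C 0%N] = [set 0], [set` C n] = N
      & forall i, (i < n)%N -> [set` C i] `<` [set` C i.+1]]]].

(* [K] as an [A]-module, by restriction of scalars along [f]. *)
Section RestrictScalars.
Variables (A : comNzRingType) (K : fieldType).

Definition rscal (f : {rmorphism A -> K}) : Type := K.

Variable f : {rmorphism A -> K}.

HB.instance Definition _ := GRing.Zmodule.copy (rscal f) K.

Definition rscal_scale (a : A) (x : rscal f) : rscal f := f a * (x : K).

Lemma rscal_scaleA a b x : rscal_scale a (rscal_scale b x) = rscal_scale (a * b) x.
Proof. by rewrite /rscal_scale rmorphM mulrA. Qed.
Lemma rscal_scale1 : left_id 1 rscal_scale.
Proof. by move=> x; rewrite /rscal_scale rmorph1 mul1r. Qed.
Lemma rscal_scaleDr : right_distributive rscal_scale +%R.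
Proof. by move=> a x y; rewrite /rscal_scale mulrDr. Qed.
Lemma rscal_scaleDl x : {morph rscal_scale^~ x : a b / a + b}.
Proof. by move=> a b; rewrite /rscal_scale rmorphD mulrDl. Qed.

HB.instance Definition _ := GRing.Zmodule_isLmodule.Build A (rscal f)
  rscal_scaleA rscal_scale1 rscal_scaleDr rscal_scaleDl.

End RestrictScalars.

Section LocalRing.
Variable A : comNzRingType.

Definition noetherian : Prop :=
  forall I : submodClosed A^o, exists s : seq A^o, I =i lspan [set` s].

Definition maximal_ideal (m : idealr A) : Prop :=
  forall I : idealr A, {subset m <= I} -> I =i m.

Definition local_ring (m : idealr A) : Prop :=
  noetherian /\ maximal_ideal m /\ forall m', maximal_ideal m' -> m' =i m.

Definition krull_dim (F : realType) : \bar F :=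
  ereal_sup [set n%:R%:E | n in [set n | exists C : nat -> prime_idealr A,
    forall i, (i < n)%N -> [set` C i] `<` [set` C i.+1]]].

End LocalRing.

(* The m-adic completion, as the ring of m-adic Cauchy sequences modulo the
   ideal of sequences converging to 0. *)
Section Completion.
Variables (A : comNzRingType) (m : idealr A).

Definition ideal_exp (p : nat) : {pred A^o} :=
  lspan [set x : A^o | exists a : 'I_p -> A,
          (forall i, a i \in m) /\ x = \prod_(i < p) a i].

HB.instance Definition _ p :=
  GRing.isSubmodClosed.Build A A^o (ideal_exp p) (lspan_subsemimod _).

Definition cauchy_seq : {pred nat -> A} := fun x =>
  `[< forall p, exists n, forall i j, (n <= i)%N -> (n <= j)%N ->
        x i - x j \in ideal_exp p >].

Definition null_seq (x : nat -> A) : Prop :=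
  forall p, exists n, forall i, (n <= i)%N -> x i \in ideal_exp p.

Lemma ideal_expMl p (a x : A) : x \in ideal_exp p -> a * x \in ideal_exp p.
Proof. by move=> xp; apply: (@rpredZ A A^o (ideal_exp p) a x xp). Qed.

Lemma cauchy_subring : GRing.subring_closed cauchy_seq.
Proof.
split=> [|x y /asboolP cx /asboolP cy|x y /asboolP cx /asboolP cy];
  apply/asboolP => p.
- by exists 0%N => i j _ _; rewrite subrr rpred0.
- have [n1 h1] := cx p; have [n2 h2] := cy p.
  exists (maxn n1 n2) => i j; rewrite !geq_max => /andP[i1 i2] /andP[j1 j2].
  rewrite -[(x - y) i]/(x i - y i) -[(x - y) j]/(x j - y j).
  have -> : x i - y i - (x j - y j) = (x i - x j) - (y i - y j).
    by rewrite !opprB [y j - x j]addrC addrACA [- y i + _]addrC.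
  by rewrite rpredB ?h1 ?h2.
- have [n1 h1] := cx p; have [n2 h2] := cy p.
  exists (maxn n1 n2) => i j; rewrite !geq_max => /andP[i1 i2] /andP[j1 j2].
  rewrite -[(x * y) i]/(x i * y i) -[(x * y) j]/(x j * y j).
  have -> : x i * y i - x j * y j = x i * (y i - y j) + y j * (x i - x j).
    by rewrite !mulrBr [y j * x i]mulrC [y j * x j]mulrC addrA subrK.
  by rewrite rpredD // ideal_expMl ?h1 ?h2.
Qed.

HB.instance Definition _ :=
  GRing.isSubringClosed.Build (nat -> A) cauchy_seq cauchy_subring.

Definition cauchy_ring : Type := {x : nat -> A | x \in cauchy_seq}.

HB.instance Definition _ := [isSub of cauchy_ring for sval].
HB.instance Definition _ := [Choice of cauchy_ring by <:].
HB.instance Definition _ := [SubChoice_isSubComNzRing of cauchy_ring by <:].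

Definition null_ideal : {pred cauchy_ring} := fun x => `[< null_seq (val x) >].

Lemma cauchy_bounded (x : cauchy_ring) y : null_seq y -> null_seq (val x * y).
Proof.
move=> ny p; have [n h] := ny p; exists n => i /h.
exact: ideal_expMl.
Qed.

Lemma ideal_exp1 x : x \in ideal_exp 1 -> x \in m.
Proof.
move=> /asboolP[n [a [g [gX ->]]]]; apply: rpred_sum => i _.
apply: idealMr; have [b [bm ->]] := gX i.
by rewrite big_ord1.
Qed.

Lemma null_ideal_closed : idealr_closed null_ideal.
Proof.
split.
- by apply/asboolP => p; exists 0%N => i _; rewrite raddf0 rpred0.
- apply/negP => /asboolP /(_ 1%N)[n /(_ n (leqnn n))].
  by move=> /ideal_exp1; rewrite rmorph1 (idealr1 m).
- move=> a x y /asboolP nx /asboolP ny; apply/asboolP => p.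
  have [n1 h1] := cauchy_bounded a nx p; have [n2 h2] := ny p.
  exists (maxn n1 n2) => i; rewrite geq_max => /andP[i1 i2].
  by rewrite rmorphD rmorphM /= rpredD ?h1 ?h2.
Qed.

HB.instance Definition _ :=
  isIdealr.Build cauchy_ring null_ideal null_ideal_closed.

Definition completion : comNzRingType := {ideal_quot null_ideal}.

Definition analytically_irreducible : Prop :=
  forall x y : completion, x * y = 0 -> x = 0 \/ y = 0.

End Completion.

Section Valuation.
Variables (R : idomainType).
Local Notation K := {fraction R}.

Definition int_closure : set K := [set x | integralOver (@tofrac R) x].

(* When [int_closure] is local, as it is for [R] analytically irreducible, its
   maximal ideal is the set of its non-units. *)
Definition int_closure_nonunit : set K :=
  [set x | int_closure x /\ ~ (x != 0 /\ int_closure x^-1)].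

(* The canonical embedding of the residue field of [R] into that of
   [int_closure] is onto. *)
Definition residually_rational : Prop :=
  forall x, int_closure x -> exists r : R, int_closure_nonunit (x - tofrac r).

(* The value of [v] at 0 is irrelevant. *)
Definition normalized_valuation (v : K -> int) (V : set K) : Prop :=
  [/\ forall x y, x != 0 -> y != 0 -> v (x * y) = v x + v y,
      forall x y, x != 0 -> y != 0 -> x + y != 0 ->
        Num.min (v x) (v y) <= v (x + y),
      exists2 x, x != 0 & v x = 1
    & forall x, x != 0 -> (V x <-> 0 <= v x)].

Definition value_set (v : K -> int) (X : set K) : set int :=
  [set v f | f in [set f | X f /\ f != 0]].

Definition frac_mod : lmodType R := rscal (@tofrac R).

Definition monomial_fractional_ideal (t : K) (I : submodClosed frac_mod) : Prop :=
  exists h (z : 'I_h.+1 -> int),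
    I =i lspan [set x : frac_mod | exists i, x = t ^ z i].

End Valuation.

Section Monomial.
Variables (k : fieldType) (n : nat).
Local Notation P := {mpoly k[n]}.
Local Notation K := {fraction P}.

(* A subspace is homogeneous for the [Z^n]-grading when it contains the
   homogeneous components of its elements. *)
Definition homogeneous (S : {pred P}) : Prop :=
  forall f, f \in S -> forall a : 'X_{1..n}, f@_a *: 'X_[a] \in S.

Definition monomial_order (le : rel 'X_{1..n}) : Prop :=
  [/\ reflexive le, antisymmetric le, transitive le & total le] /\
  (forall a, le 0%MM a) /\
  (forall a b c, le a b -> le (a + c)%MM (b + c)%MM).

Definition lead_exp (le : rel 'X_{1..n}) (f : P) (a : 'X_{1..n}) : Prop :=
  a \in msupp f /\ forall b, b \in msupp f -> le b a.

Definition deg_set (le : rel 'X_{1..n}) (X : set K) : set 'rV[int]_n :=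
  [set w | exists f g a b, [/\ X (tofrac f / tofrac g),
      lead_exp le f a, lead_exp le g b & w = \row_i ((a i)%:Z - (b i)%:Z)]].

Definition laurent (w : 'rV[int]_n) : K :=
  \prod_(i < n) (tofrac 'X_i : K) ^ w 0 i.

Section Subalgebra.
Variable S : subalgClosed P.

(* [subalgClosed] does not inherit from [subringClosed] in the library. *)
Definition subring_of_subalg : {pred P} := S.

Lemma subring_of_subalg_closed : GRing.subring_closed subring_of_subalg.
Proof.
rewrite /subring_of_subalg; split=> [|x y Sx Sy|x y Sx Sy]; rewrite ?rpred1 ?rpredM //.
by rewrite -scaleN1r rpredD ?rpredZ.
Qed.

HB.instance Definition _ :=
  GRing.isSubringClosed.Build P subring_of_subalg subring_of_subalg_closed.

Definition subalg_ring : Type := {f : P | f \in subring_of_subalg}.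

HB.instance Definition _ := [isSub of subalg_ring for sval].
HB.instance Definition _ := [Choice of subalg_ring by <:].
HB.instance Definition _ := [SubChoice_isSubComNzRing of subalg_ring by <:].

Definition subalg_frac : subalg_ring -> K := @tofrac P \o val.

HB.instance Definition _ := GRing.RMorphism.on subalg_frac.

(* The ambient fraction field of [k[x_1, ..., x_n]] as an [S]-module; it
   contains the fraction field of [S]. *)
Definition subalg_frac_mod : lmodType subalg_ring := rscal subalg_frac.

Definition in_frac_field (x : K) : Prop :=
  exists a b, [/\ a \in S, b \in S, b != 0 & x = tofrac a / tofrac b].

Definition monomial_fractional_ideal_of (I : submodClosed subalg_frac_mod) : Prop :=
  exists h (w : 'I_h.+1 -> 'rV[int]_n),
    (forall i, in_frac_field (laurent (w i))) /\
    I =i lspan [set x : subalg_frac_mod | exists i, x = laurent (w i)].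

End Subalgebra.
End Monomial.

Section RelativeTensor.
Variables (G : zmodType) (S A B : set G).

Definition rel_pairs : Type := {p : G * G | `[< A p.1 /\ B p.2 >]}.

HB.instance Definition _ := [isSub of rel_pairs for sval].
HB.instance Definition _ := [Choice of rel_pairs by <:].

Definition rel_step (p q : rel_pairs) : Prop :=
  exists a b s, [/\ S s, val p = (s + a, b) & val q = (a, s + b)].

Definition rel_equiv (p q : rel_pairs) : bool :=
  `[< clos_refl_sym_trans rel_pairs rel_step p q >].

Lemma rel_equiv_is_equiv : equiv_class_of rel_equiv.
Proof.
split=> [p|p q|q p r].
- exact/asboolP/rst_refl.
- by apply/asboolP/asboolP; apply: rst_sym.
- by move=> /asboolP pq /asboolP qr; apply/asboolP; apply: rst_trans qr.
Qed.

Canonical rel_equiv_equiv := EquivRelPack rel_equiv_is_equiv.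
Canonical rel_equiv_encModRel := defaultEncModRel rel_equiv.

Definition rel_tensor : Type := {eq_quot rel_equiv}.

HB.instance Definition _ := Choice.on rel_tensor.

Definition chi (c : rel_tensor) : G :=
  let p := val (repr (c : {eq_quot rel_equiv})) in p.1 + p.2.

Lemma chiE (p : rel_pairs) :
  chi (\pi_({eq_quot rel_equiv}) p) = (val p).1 + (val p).2.
Proof.
rewrite /chi; set q := repr _.
have : q == p %[mod {eq_quot rel_equiv}] by rewrite reprK.
rewrite piE => /asboolP; elim=> {q p}// [p q [a [b [s [_ -> ->]]]]|p q r _ -> _ //].
by rewrite /= -addrA addrCA.
Qed.

Definition tau_at (F : realType) (z : G) : \bar F :=
  (maxe 0 (counting (chi @^-1` [set z]) - 1))%E.

Definition tau (F : realType) : \bar F := \esum_(z in [set: G]) tau_at F z.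

End RelativeTensor.

(* Main.v *)
From HB Require Import structures.
Require Import Defs.
From Stdlib Require Import Relations.
From mathcomp Require Import all_boot all_order all_algebra.
From mathcomp Require Import finmap zify.
From mathcomp Require Import monalg.
From mathcomp Require Import mpoly.
From mathcomp Require Import boolp classical_sets functions cardinality fsbigop reals.
From mathcomp Require Import ereal esum measure.

Set Implicit Arguments.
Unset Strict Implicit.
Unset Printing Implicit Defensive.

Import Order.TTheory GRing.Theory Num.Theory.
Local Open Scope classical_set_scope.
Local Open Scope ring_scope.

(** Write [K] for the fraction field, and [X a] for the monomial of exponent [a]
in [K]. Both halves of the statement are cases of [torsion_length_monomial],
which treats a ring [R] inside [K], a submonoid [S] of a group [G] with
[X s] in [R] for [s] in [S], and fractional ideals [I] and [J] spanned over [R]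
by the monomials with exponents in [S]-stable sets [A] and [B].

The hypothesis that carries everything is [binomial_relations]: the relations
[X s * X a = X (s + a)] generate all the [R]-linear relations between monomials.
It says that [I] is the [R]-module presented by generators [X a], [a] in [A], and
these relations. Tensoring the presentations of [I] and [J] shows that the tensor
product [M] of [I] and [J] is generated by elements [e c], indexed by the classes
[c] of [A] tensor [B] over [S], subject only to the relations [x^s e c = e (s + c)]
([tensor_presents]).

The torsion of [M] is the kernel of the map to [K] that sends [e c] to
[X (chi c)]. Using [binomial_relations] once more, this kernel is spanned by the
differences [e c - e c'] with [chi c = chi c'] ([torsion_class_diffs]). Fix one
class in each nonempty fibre of [chi], and subtract its element from the others of
the fibre: this leaves one generator of the torsion for every class that is not
the fixed one in its fibre, and these classes are counted by [tau]
([tau_counting]). The length is then computed as for a vector space with this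
basis.
 - Sort the generators by degree. The monomials of nonzero exponent, which
   generate a maximal ideal of [R], send each generator into the span of those of
   larger degree. So the torsion is filtered with as many steps as there are
   generators, each quotient being simple or zero ([chain_le_size]).
 - No generator lies in the span of the later ones ([class_diff_independent]), so
   the filtration is strict. Over a field one would read off a coefficient; as [R]
   need not contain a field, the coefficient is replaced by a linear map from [M]
   to [K / W], where [W] is spanned by the [X z] with [- z] not in [S]
   ([dual_functional]). When [R] is a monomial algebra, [K / W] contains the graded
   dual of [R].

It remains to prove [binomial_relations] in the two cases. For a monomial algebra
one expands the coefficients over the base field and compares Laurent monomials
([monomial_algebra_binomial]). For the valuation, an element of [R] is either a
unit of value 0 or a combination of the generators [t^d] of the maximal ideal; so
a combination of monomials of value at least [p] either has value exactly [p],
or can be rewritten by binomial relations with monomials of value at least [p + 1]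
([filt_step]). A combination that vanishes is therefore rewritten with monomials
of arbitrarily large value, and beyond the conductor these are all multiples of a
single one ([valuation_binomial]). The same rewriting shows that [t] has value 1
and that values of elements of [R], [I] and [J] are exponents of monomials. *)

(** * Spans, quotients and tensor products *)
Section Modules.
Variable A : comNzRingType.

Lemma pack_linear (M Y : lmodType A) (h : M -> Y) :
  linear h -> exists g : {linear M -> Y}, g =1 h.
Proof.
move=> hL; pose hM := GRing.isLinear.Build A M Y *:%R h hL.
by exists (HB.pack h hM : {linear M -> Y}).
Qed.

Lemma lspan_min (M : lmodType A) (X : set M) (N : submodClosed M) :
  (forall x, X x -> x \in N) -> {subset lspan X <= N}.
Proof.
move=> XN x /asboolP[n [a [g [gX ->]]]].
by apply: rpred_sum => i _; apply: rpredZ; apply: XN.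
Qed.

Lemma lspan_le (M : lmodType A) (X Y : set M) :
  X `<=` Y -> {subset lspan X <= lspan Y}.
Proof. by move=> XY; apply: lspan_min => x /XY; apply: mem_lspan. Qed.

(** Coefficients and indices are kept together in a list, because the relations
between monomials below are stated for lists, which concatenate easily. *)
Lemma lspan_family (M : lmodType A) (G : choiceType) (D : set G) (X : G -> M) x :
  x \in lspan [set X a | a in D] ->
  exists2 s : seq (A * G), (forall p, p \in s -> D p.2) &
    x = \sum_(p <- s) p.1 *: X p.2.
Proof.
move=> /asboolP[n [c [g [gX ->]]]].
pose a i := sval (cid2 (gX i)).
have aD i : D (a i) by rewrite /a; case: cid2.
have aE i : X (a i) = g i by rewrite /a; case: cid2.
exists [seq (c i, a i) | i <- enum 'I_n].
  by move=> p /mapP[i _ ->] /=.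
by rewrite big_map big_enum; apply: eq_bigr => i _; rewrite /= aE.
Qed.

Lemma lspan_cons (M : lmodType A) (X : set M) (d : M) (N : submodClosed M) x :
  (forall y, X y -> y = d \/ y \in N) -> x \in lspan X ->
  exists r, x - r *: d \in N.
Proof.
move=> XdN /asboolP[n [a [g [gX ->]]]].
exists (\sum_(i < n | g i == d) a i).
rewrite (bigID (fun i => g i == d)) /= scaler_suml addrAC.
rewrite (eq_bigr (fun i => a i *: d)) => [|i /eqP-> //].
rewrite subrr add0r; apply: rpred_sum => i gid; apply: rpredZ.
by case: (XdN _ (gX i)) => // e; rewrite e eqxx in gid.
Qed.

Lemma quotmod_pi_linear (M : lmodType A) (N : submodClosed M) :
  linear (@quotmod_pi A M N).
Proof. by move=> a x y; rewrite quotmod_piD -quotmod_piZ. Qed.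

HB.instance Definition _ (M : lmodType A) (N : submodClosed M) :=
  GRing.isLinear.Build A M (quotmod N) *:%R (@quotmod_pi A M N)
    (@quotmod_pi_linear M N).

Lemma quotmod_pi0 (M : lmodType A) (N : submodClosed M) x :
  (quotmod_pi N x = 0) <-> x \in N.
Proof. by rewrite -[X in _ = X](linear0 (quotmod_pi N)) quotmod_piE subr0. Qed.

Lemma quotmod_lift (M Y : lmodType A) (N : submodClosed M) (h : {linear M -> Y}) :
  (forall x, x \in N -> h x = 0) ->
  exists g : {linear quotmod N -> Y}, forall x, g (quotmod_pi N x) = h x.
Proof.
move=> hN.
pose g (x : quotmod N) := h (repr (x : Quotient.quot (zmod_of_submod N))).
have gE x : g (quotmod_pi N x) = h x.
  apply/eqP; rewrite -subr_eq0 -linearB; apply/eqP/hN.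
  by apply/quotmod_piE; rewrite quotmod_piK.
have gL : linear g.
  move=> a x y; rewrite -[x]quotmod_piK -[y]quotmod_piK -linearP !gE.
  by rewrite linearP.
by have [G GE] := pack_linear gL; exists G => x; rewrite GE gE.
Qed.

(** The library maps out of [malg] are ring-valued; this is the universal property
of the free module. *)
Lemma malg_lift (T : choiceType) (Y : lmodType A) (b : T -> Y) :
  exists g : {linear {malg A[T]} -> Y}, forall k, g << k >> = b k.
Proof.
pose g (p : {malg A[T]}) := \sum_(k <- monalg.msupp p) monalg.mcoeff k p *: b k.
have gE (p : {malg A[T]}) (d : {fset T}) : (monalg.msupp p `<=` d)%fset ->
    g p = \sum_(k <- d) monalg.mcoeff k p *: b k.
  move=> pd; rewrite /g (big_fset_incl _ pd) // => k _ kp.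
  by rewrite monalg.mcoeff_outdom // scale0r.
have gL : linear g.
  move=> a p q; set d := (monalg.msupp p `|` monalg.msupp q `|`
    monalg.msupp (a *: p + q))%fset.
  rewrite (gE _ d) ?(gE p d) ?(gE q d) ?fsubsetUr //; last 2 first.
  - by rewrite /d -fsetUA fsetUCA fsubsetUl.
  - by rewrite /d -fsetUA fsubsetUl.
  rewrite scaler_sumr -big_split; apply: eq_bigr => k _ /=.
  by rewrite monalg.mcoeffD monalg.mcoeffZ scalerDl scalerA.
have [G GE] := pack_linear gL; exists G => k.
rewrite GE (gE _ [fset k]%fset) ?monalg.msuppU_le // big_seq_fset1.
by rewrite monalg.mcoeffUU scale1r.
Qed.

Lemma malgU_scale (T : choiceType) (a : A) (k : T) :
  << a *g k >> = a *: (<< k >> : {malg A[T]}).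
Proof.
by apply/monalg.malgP => l; rewrite monalg.mcoeffZ !monalg.mcoeffU mulrnAr mulr1.
Qed.

Section TensorMap.
Variables (M N : lmodType A).

Lemma tensor_eltDl (x x' : M) (y : N) :
  tensor_elt (x + x') y = tensor_elt x y + tensor_elt x' y.
Proof.
rewrite /tensor_elt -linearD; apply/quotmod_piE; apply: mem_lspan.
by left; exists x, x', y; rewrite opprD addrA.
Qed.

Lemma tensor_eltDr (x : M) (y y' : N) :
  tensor_elt x (y + y') = tensor_elt x y + tensor_elt x y'.
Proof.
rewrite /tensor_elt -linearD; apply/quotmod_piE; apply: mem_lspan.
by right; left; exists x, y, y'; rewrite opprD addrA.
Qed.

Lemma tensor_eltZl a (x : M) (y : N) :
  tensor_elt (a *: x) y = a *: tensor_elt x y.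
Proof.
rewrite /tensor_elt -linearZ; apply/quotmod_piE; apply: mem_lspan.
by do 2 right; left; exists a, x, y.
Qed.

Lemma tensor_eltZr a (x : M) (y : N) :
  tensor_elt x (a *: y) = a *: tensor_elt x y.
Proof.
rewrite /tensor_elt -linearZ; apply/quotmod_piE; apply: mem_lspan.
by do 3 right; exists a, x, y.
Qed.

Lemma tensor_lift (Y : lmodType A) (b : M -> N -> Y) :
  (forall y, linear (b^~ y)) -> (forall x, linear (b x)) ->
  exists g : {linear tensor M N -> Y}, forall x y, g (tensor_elt x y) = b x y.
Proof.
move=> bl br.
have [h hE] := malg_lift (fun p : M * N => b p.1 p.2).
have [|g gE] := @quotmod_lift _ _ (lspan (@bilin_rels A M N)) h.
  move=> x /asboolP[n [a [r [rX ->]]]]; rewrite linear_sum big1 // => i _.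
  rewrite linearZ /=; suff -> : h (r i) = 0 by rewrite scaler0.
  case: (rX i) => [[u [u' [w ->]]]|[[u [w [w' ->]]]|[[c [u [w ->]]]|[c [u [w ->]]]]]].
  - rewrite !linearB /= !hE /=; have := bl w 1 u u'; rewrite !scale1r => ->.
    by rewrite addrAC addrK subrr.
  - rewrite !linearB /= !hE /=; have := br u 1 w w'; rewrite !scale1r => ->.
    by rewrite addrAC addrK subrr.
  - rewrite linearB linearZ /= !hE /=; have := bl w c u 0; rewrite addr0 => ->.
    have := bl w 1 0 0; rewrite !scale1r addr0 => /eqP.
    by rewrite -subr_eq0 opprD addrA subrr add0r oppr_eq0 => /eqP->; rewrite addr0 subrr.
  - rewrite linearB linearZ /= !hE /=; have := br u c w 0; rewrite addr0 => ->.
    have := br u 1 0 0; rewrite !scale1r addr0 => /eqP.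
    by rewrite -subr_eq0 opprD addrA subrr add0r oppr_eq0 => /eqP->; rewrite addr0 subrr.
by exists g => x y; rewrite /tensor_elt gE hE.
Qed.

Lemma tensor_ind (P : tensor M N -> Prop) :
  (forall c z z', P z -> P z' -> P (c *: z + z')) -> P 0 ->
  (forall x y, P (tensor_elt x y)) -> forall z, P z.
Proof.
move=> PD P0 Pe z; rewrite -[z]quotmod_piK.
move: (repr _) => p; rewrite (monalgE p) linear_sum.
apply: (big_ind P) => //= [u w Pu Pw|[x y] _].
  by rewrite -[u]scale1r; apply: PD.
rewrite malgU_scale linearZ /= -[X in P X]addr0; apply: PD => //; exact: Pe.
Qed.

Lemma tensor_eltl_linear (y : N) : linear (fun x : M => tensor_elt x y).
Proof. by move=> a x x'; rewrite tensor_eltDl tensor_eltZl. Qed.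

Lemma tensor_eltr_linear (x : M) : linear (fun y : N => tensor_elt x y).
Proof. by move=> a y y'; rewrite tensor_eltDr tensor_eltZr. Qed.

Lemma tensor_span (U : set M) (V : set N) :
  (forall x, x \in lspan U) -> (forall y, y \in lspan V) ->
  forall z : tensor M N, z \in lspan [set tensor_elt x y | x in U & y in V].
Proof.
move=> MU NV z; elim/tensor_ind: z => [c z z' Lz Lz'||x y].
- by rewrite rpredD // rpredZ.
- exact: rpred0.
have /asboolP[n [a [g [gU ->]]]] := MU x; have /asboolP[p [b [h [hV ->]]]] := NV y.
have [l lE] := pack_linear (tensor_eltl_linear (\sum_(i < p) b i *: h i)).
rewrite -lE linear_sum; apply: rpred_sum => i _; rewrite linearZ /= lE rpredZ //.
have [r rE] := pack_linear (tensor_eltr_linear (g i)).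
rewrite -rE linear_sum; apply: rpred_sum => j _; rewrite linearZ /= rE rpredZ //.
by apply: mem_lspan; exists (g i) => //; exists (h j).
Qed.

End TensorMap.

(** Attach to a submodule [L] the set of steps [i] at which [L] has an element in
[Fil i] but not in [Fil i.+1]. When the steps are simple, two nested submodules
with the same set are equal, by descending induction along the filtration; so the
sets grow strictly along a strict chain. *)
Lemma chain_bound (M : lmodType A) (Fil : nat -> submodClosed M) (N : nat) :
  (forall x, x \in Fil N -> x = 0) ->
  (forall i x y, (i < N)%N -> x \in Fil i -> y \in Fil i -> y \notin Fil i.+1 ->
     exists r, x - r *: y \in Fil i.+1) ->
  forall (n : nat) (C : nat -> submodClosed M),
    {subset C n <= Fil 0} ->
    (forall i, (i < n)%N -> [set` C i] `<` [set` C i.+1]) -> (n <= N)%N.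
Proof.
move=> FilN Fsimple n C CF Cs.
pose jump (L : submodClosed M) : {set 'I_N} :=
  finset (fun i : 'I_N => `[< exists2 x, x \in L & (x \in Fil i) && (x \notin Fil i.+1) >]).
have jumpE (L : submodClosed M) (i : 'I_N) : reflect
    (exists2 x, x \in L & (x \in Fil i) && (x \notin Fil i.+1)) (i \in jump L).
  by rewrite finset.in_set; apply: asboolP.
have jumpP (L L' : submodClosed M) : {subset L <= L'} -> jump L \subset jump L'.
  move=> LL'; apply/fintype.subsetP => i; move=> /jumpE[x xL xi].
  by apply/jumpE; exists x => //; apply: LL'.
have jump_eq (L L' : submodClosed M) : {subset L <= L'} -> {subset L' <= Fil 0} ->
    jump L = jump L' -> {subset L' <= L}.
  move=> LL' L'F eJ.
  suff key d x : (d <= N)%N -> x \in L' -> x \in Fil (N - d)%N -> x \in L.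
    by move=> x xL'; apply: (key N) => //; rewrite subnn; apply: L'F.
  elim: d x => [|d IH] x dN xL' xF.
    by move: xF; rewrite subn0 => /FilN->; rewrite rpred0.
  have iN : (N - d.+1 < N)%N by rewrite ltn_subrL /= (leq_trans _ dN).
  have ei : (N - d.+1).+1 = (N - d)%N by rewrite subnSK.
  have [xF1|xF1] := boolP (x \in Fil (N - d.+1).+1).
    by apply: IH => //; [exact: ltnW | rewrite -ei].
  have : Ordinal iN \in jump L'.
    by apply/jumpE; exists x => //=; rewrite xF xF1.
  rewrite -eJ => /jumpE[y yL /= /andP[yF yF1]].
  have [r rF] := Fsimple _ x y iN xF yF yF1.
  rewrite -(subrK (r *: y) x) rpredD ?rpredZ //.
  apply: IH; [exact: ltnW | | by rewrite -ei].
  by rewrite -scaleNr rpredD // rpredZ //; apply: LL'.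
have Csub i : (i < n)%N -> {subset C i <= C i.+1}.
  by move=> /Cs[sub _] x; apply: sub.
have CFi d i : (i + d = n)%N -> {subset C i <= Fil 0}.
  elim: d i => [|d IH] i; first by rewrite addn0 => ->.
  move=> e x xC; apply: (IH i.+1); first by rewrite addSnnS.
  by apply: Csub => //; rewrite -e -[ltnLHS]addn0 ltn_add2l.
have card_jump i : (i <= n)%N -> (i <= #|jump (C i)|)%N.
  elim: i => [//|i IH] lt_in; apply: leq_ltn_trans (IH (ltnW lt_in)) _.
  apply: proper_card; rewrite finset.properEneq jumpP ?andbT; last exact: Csub.
  apply/eqP => eJ; have [_ []] := Cs i lt_in.
  by move=> x; apply: jump_eq eJ x; [exact: Csub | exact: CFi (subnKC lt_in)].
by apply: leq_trans (card_jump n (leqnn n)) _; rewrite -[leqRHS]card_ord max_card.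
Qed.

End Modules.

(** * Modules presented by monomials and binomial relations *)
Section Binomial.
Variables (R : comNzRingType) (K : fieldType) (f : {rmorphism R -> K}).
Variables (G : zmodType) (S : set G) (X : G -> K) (mu : G -> R).

Definition stable (D : set G) := forall s a, S s -> D a -> D (s + a).

Definition compatible (P : lmodType R) (D : set G) (y : G -> P) :=
  forall s a, S s -> D a -> mu s *: y a = y (s + a).

(** Stated by testing against all modules [P] with a family [y] that satisfies the
binomial relations, rather than with the presented module itself. *)
Definition binomial_relations := forall (D : set G) (P : lmodType R) (y : G -> P),
  stable D -> compatible D y ->
  forall s : seq (R * G), (forall p, p \in s -> D p.2) ->
  \sum_(p <- s) f p.1 * X p.2 = 0 -> \sum_(p <- s) p.1 *: y p.2 = 0.

Hypothesis S_binomial : binomial_relations.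

Definition expansion (D : set G) (x : rscal f) (s : seq (R * G)) :=
  (forall p, p \in s -> D p.2) /\ x = \sum_(p <- s) f p.1 * X p.2.

(** The linear map that sends the monomial [X a] to [y a]: an expansion of [x] in
monomials is chosen, and [extendE] shows that the choice is immaterial. *)
Definition extend (P : lmodType R) (D : set G) (y : G -> P) (x : rscal f) : P :=
  \sum_(p <- xget [::] [set s | expansion D x s]) p.1 *: y p.2.

Lemma expansion_lspan (D : set G) x :
  x \in lspan [set (X a : rscal f) | a in D] -> exists s, expansion D x s.
Proof. by move=> /lspan_family[s sD ->]; exists s; split. Qed.

Lemma extendE (P : lmodType R) D (y : G -> P) x s :
  stable D -> compatible D y -> expansion D x s ->
  extend D y x = \sum_(p <- s) p.1 *: y p.2.
Proof.
move=> Dst yc [sD xs]; rewrite /extend; case: xgetP => [s' _ [s'D xs']|/(_ s)[]//].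
apply/eqP; rewrite -subr_eq0; apply/eqP.
have := S_binomial Dst yc (s := s' ++ [seq (- p.1, p.2) | p <- s]).
rewrite !big_cat !big_map /= => H; rewrite -[RHS]H.
- by congr (_ + _); rewrite -sumrN; apply: eq_bigr => p _; rewrite scaleNr.
- move=> p; rewrite mem_cat => /orP[/s'D//|/mapP[q /sD ? ->//]].
- rewrite -xs' [X in X + _]xs -big_split big1 // => p _ /=.
  by rewrite rmorphN mulNr subrr.
Qed.

Lemma extend_eq (P : lmodType R) D (y y' : G -> P) x :
  (exists s, expansion D x s) -> (forall a, D a -> y a = y' a) ->
  extend D y x = extend D y' x.
Proof.
move=> [s xs] yy'; rewrite /extend.
case: xgetP => [s' _ [s'D _]|/(_ s)[]//].
by apply: eq_big_seq => p /s'D Dp; rewrite yy'.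
Qed.

Lemma extend_monomial (P : lmodType R) D (y : G -> P) a :
  stable D -> compatible D y -> D a -> extend D y (X a) = y a.
Proof.
move=> Dst yc Da; rewrite (@extendE _ _ _ _ [:: (1, a)]) //.
  by rewrite big_seq1 scale1r.
by split=> [p|]; rewrite ?big_seq1 ?rmorph1 ?mul1r // inE => /eqP->.
Qed.

Lemma extend_linear (P : lmodType R) D (y : G -> P) c x x' :
  stable D -> compatible D y ->
  (exists s, expansion D x s) -> (exists s, expansion D x' s) ->
  extend D y (c *: x + x') = c *: extend D y x + extend D y x'.
Proof.
move=> Dst yc [s xs] [s' xs'].
rewrite (extendE Dst yc xs) (extendE Dst yc xs').
rewrite (@extendE _ _ _ _ ([seq (c * p.1, p.2) | p <- s] ++ s')) //.
  rewrite big_cat big_map /= scaler_sumr; congr (_ + _).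
  by apply: eq_bigr => p _; rewrite scalerA.
case: xs xs' => [sD ->] [s'D ->]; split.
  by move=> p; rewrite mem_cat => /orP[/mapP[q /sD ? ->//]|/s'D].
rewrite big_cat big_map /=; congr (_ + _).
rewrite -[c *: _]/(f c * _) mulr_sumr.
by apply: eq_bigr => p _; rewrite rmorphM mulrA.
Qed.

Lemma extend_family_linear (P : lmodType R) D (y y' : G -> P) c x :
  extend D (fun a => c *: y a + y' a) x = c *: extend D y x + extend D y' x.
Proof.
rewrite /extend scaler_sumr -big_split; apply: eq_bigr => p _ /=.
by rewrite scalerDr !scalerA mulrC.
Qed.

(** [e] makes [M] the module presented by generators [e a b] and the relations of
the tensor product of sets over [S]. The study of the torsion uses only this
property of the tensor product of the two ideals. *)
Record presents_tensor (A B : set G) (M : lmodType R) (e : G -> G -> M) : Prop := {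
  presentsl : forall s a b, S s -> A a -> B b -> mu s *: e a b = e (s + a) b;
  presentsr : forall s a b, S s -> A a -> B b -> mu s *: e a b = e a (s + b);
  presents_span : forall z,
    z \in lspan [set x | exists a b, [/\ A a, B b & x = e a b]];
  presents_lift : forall (Y : lmodType R) (eta : G -> G -> Y),
    (forall s a b, S s -> A a -> B b -> mu s *: eta a b = eta (s + a) b) ->
    (forall s a b, S s -> A a -> B b -> mu s *: eta a b = eta a (s + b)) ->
    exists g : {linear M -> Y}, forall a b, A a -> B b -> g (e a b) = eta a b
}.

Section MonomialSubmodule.
Variables (A : set G) (I : submodClosed (rscal f)).
Hypothesis Ast : stable A.
Hypothesis I_span : I =i lspan [set (X a : rscal f) | a in A].

Definition mon (a : G) : submod I := insubd (0 : submod I) (X a : rscal f).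

Lemma val_mon a : A a -> val (mon a) = X a.
Proof.
move=> Aa; rewrite insubdK // -topredE /=.
by have -> : (X a : rscal f) \in I by rewrite I_span; apply: mem_lspan; exists a.
Qed.

Lemma submod_expansion (x : submod I) : exists s, expansion A (val x) s.
Proof. by apply: expansion_lspan; rewrite -I_span; apply: valP. Qed.

Lemma mon_span (x : submod I) : x \in lspan [set mon a | a in A].
Proof.
have [s [sA xs]] := submod_expansion x.
have -> : x = \sum_(p <- s) p.1 *: mon p.2.
  apply: val_inj; rewrite linear_sum xs.
  by apply: eq_big_seq => p /sA Ap; rewrite linearZ /= val_mon.
rewrite big_seq; apply: rpred_sum => p /sA Ap; apply: rpredZ.
by apply: mem_lspan; exists p.2.
Qed.

Hypotheses (XD : forall a b, X (a + b) = X a * X b).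
Hypothesis (muE : forall s, S s -> f (mu s) = X s).

Lemma mu_mon s a : S s -> A a -> mu s *: mon a = mon (s + a).
Proof.
move=> Ss Aa; apply: val_inj; rewrite linearZ /= !val_mon //; last exact: Ast.
by rewrite -[_ *: _]/(f _ * _) muE // XD.
Qed.

End MonomialSubmodule.

Section MonomialTensor.
Variables (A B : set G) (I J : submodClosed (rscal f)).
Hypotheses (Ast : stable A) (Bst : stable B).
Hypothesis I_span : I =i lspan [set (X a : rscal f) | a in A].
Hypothesis J_span : J =i lspan [set (X b : rscal f) | b in B].

Definition mon_tensor (a b : G) : tensor (submod I) (submod J) :=
  tensor_elt (mon I a) (mon J b).

(** [I] and [J] being presented by their monomials, a family [eta] extends to a
linear map in the first variable, for each monomial of [J], and the result extends
in the second variable to a bilinear map. *)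
Lemma mon_tensor_lift (Y : lmodType R) (eta : G -> G -> Y) :
  (forall s a b, S s -> A a -> B b -> mu s *: eta a b = eta (s + a) b) ->
  (forall s a b, S s -> A a -> B b -> mu s *: eta a b = eta a (s + b)) ->
  exists g : {linear tensor (submod I) (submod J) -> Y},
    forall a b, A a -> B b -> g (mon_tensor a b) = eta a b.
Proof.
move=> etal etar.
have cl b : B b -> compatible A (eta^~ b) by move=> Bb s a Ss Aa; apply: etal.
pose h (x : submod I) b := extend A (eta^~ b) (val x).
have cr x : compatible B (h x).
  move=> s b Ss Bb; have [e xe] := submod_expansion I_span x.
  have Bsb : B (s + b) by apply: Bst.
  rewrite /h !(extendE Ast (cl _ _) xe) // scaler_sumr.
  apply: eq_big_seq => p /(proj1 xe) Ap.
  by rewrite -etar // !scalerA mulrC.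
pose beta (x : submod I) (w : submod J) := extend B (h x) (val w).
have bl w : linear (beta^~ w).
  move=> c x x'; rewrite /beta -extend_family_linear.
  apply: extend_eq; first exact: submod_expansion J_span w.
  move=> b Bb; rewrite /h linearP /=.
  by rewrite (extend_linear _ Ast (cl _ Bb)) //; apply: submod_expansion I_span _.
have br x : linear (beta x).
  move=> c w w'; rewrite /beta linearP /=.
  by rewrite (extend_linear _ Bst (cr x)) //; apply: submod_expansion J_span _.
have [g gE] := tensor_lift bl br.
exists g => a b Aa Bb; rewrite gE /beta (val_mon J_span Bb) extend_monomial //.
by rewrite /h (val_mon I_span Aa) extend_monomial //; apply: cl.
Qed.

Hypotheses (XD : forall a b, X (a + b) = X a * X b).
Hypothesis (muE : forall s, S s -> f (mu s) = X s).

Lemma tensor_presents : presents_tensor A B mon_tensor.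
Proof.
split=> [s a b Ss Aa _|s a b Ss _ Bb|z|Y eta]; last exact: mon_tensor_lift.
- by rewrite /mon_tensor -tensor_eltZl (mu_mon Ast I_span).
- by rewrite /mon_tensor -tensor_eltZr (mu_mon Bst J_span).
have := tensor_span (mon_span I_span) (mon_span J_span) z; apply: lspan_le.
by move=> _ [_ [a Aa <-] [_ [b Bb <-] <-]]; exists a, b.
Qed.

End MonomialTensor.

(** * Torsion of a module presented by classes *)
Section Presented.
Local Open Scope quotient_scope.
Variables (A B : set G).
Hypotheses (Ast : stable A) (Bst : stable B).
Hypotheses (finj : injective f) (XD : forall a b, X (a + b) = X a * X b).
Hypothesis (muE : forall s, S s -> f (mu s) = X s).

Variables (M : lmodType R) (mon_tensor : G -> G -> M).
Hypothesis Mpres : presents_tensor A B mon_tensor.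

Let mon_tensorl := presentsl Mpres.
Let mon_tensorr := presentsr Mpres.
Let mon_tensor_lift := presents_lift Mpres.

Local Notation C := (rel_tensor S A B).

Definition class_elt (c : C) : M :=
  let p := val (repr (c : {eq_quot (@rel_equiv G S A B)})) in mon_tensor p.1 p.2.

Lemma rel_pairP (p : rel_pairs A B) : A (val p).1 /\ B (val p).2.
Proof. exact/asboolP/(valP p). Qed.

Definition rel_pair_of a b (Aa : A a) (Bb : B b) : rel_pairs A B :=
  exist _ (a, b) (asboolT (conj Aa Bb)).

Local Notation cls p := (\pi_({eq_quot (@rel_equiv G S A B)}) p : C).

(** Both pairs of an elementary step of the equivalence give the same multiple of
one element, by bilinearity. *)
Lemma class_eltE (p : rel_pairs A B) :
  class_elt (cls p) = mon_tensor (val p).1 (val p).2.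
Proof.
rewrite /class_elt; set q := repr _.
have : q == p %[mod {eq_quot (@rel_equiv G S A B)}] by rewrite reprK.
rewrite piE => /asboolP; elim=> {q p} [p q [a [b [s [Ss ep eq]]]]|p|p q _ ->|p q r _ -> _ ->];
  [|reflexivity..].
have [Aq _] := rel_pairP q; have [_ Bp] := rel_pairP p; move: Aq Bp.
by rewrite ep eq /= => Aa Bb; rewrite -mon_tensorl // mon_tensorr.
Qed.

Lemma class_rect (P : C -> Prop) : (forall p, P (cls p)) -> forall c, P c.
Proof. by move=> H c; rewrite -[c](@reprK _ {eq_quot (@rel_equiv G S A B)}). Qed.

Lemma class_elt_shift s (c : C) : S s ->
  exists2 c' : C, chi c' = s + chi c & mu s *: class_elt c = class_elt c'.
Proof.
move=> Ss; elim/class_rect: c => p; have [Aa Bb] := rel_pairP p.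
exists (cls (rel_pair_of (Ast Ss Aa) Bb)); first by rewrite !chiE /= addrA.
by rewrite !class_eltE /= mon_tensorl.
Qed.

Lemma class_elt_span (z : M) : z \in lspan [set class_elt c | c in [set: C]].
Proof.
have := presents_span Mpres z; apply: lspan_le.
move=> _ [a [b [Aa Bb ->]]].
by exists (cls (rel_pair_of Aa Bb)); rewrite ?class_eltE.
Qed.

Lemma product_map : exists g : {linear M -> rscal f},
  forall c, g (class_elt c) = X (chi c).
Proof.
have [||g gE] := @mon_tensor_lift (rscal f) (fun a b => X (a + b)).
- by move=> s a b Ss _ _; rewrite -[_ *: _]/(f _ * _) muE // -XD addrA.
- by move=> s a b Ss _ _; rewrite -[_ *: _]/(f _ * _) muE // -XD addrCA.
exists g; elim/class_rect => p; have [Aa Bb] := rel_pairP p.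
by rewrite class_eltE gE // chiE.
Qed.

(** One class is chosen in each fibre of [chi]: [choose] depends only on the fibre. *)
Definition class_rep (c : C) : C := choose [pred c' : C | chi c' == chi c] c.

Lemma chi_class_rep c : chi (class_rep c) = chi c.
Proof. by apply/eqP; have := @chooseP _ [pred c' : C | chi c' == chi c] c (eqxx _). Qed.

Lemma class_rep_eq c c' : chi c = chi c' -> class_rep c = class_rep c'.
Proof.
move=> e; rewrite /class_rep e; apply: choose_id; rewrite /= ?e //.
Qed.

Definition class_diff (c : C) : M := class_elt c - class_elt (class_rep c).

Definition class_diffs : submodClosed M := lspan [set class_diff c | c in [set: C]].

Lemma class_diff_rep c : class_diff (class_rep c) = 0.
Proof. by rewrite /class_diff (class_rep_eq (chi_class_rep c)) subrr. Qed.

Lemma class_diffB (c c' : C) : chi c = chi c' ->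
  class_elt c - class_elt c' = class_diff c - class_diff c'.
Proof. by move=> /class_rep_eq e; rewrite /class_diff e opprB addrA subrK. Qed.

Lemma class_diff_shift s c : S s -> exists c1 c2 : C,
  [/\ chi c1 = s + chi c, chi c2 = s + chi c & mu s *: class_diff c = class_diff c1 - class_diff c2].
Proof.
move=> Ss; have [c1 e1 E1] := class_elt_shift c Ss.
have [c2 e2 E2] := class_elt_shift (class_rep c) Ss.
rewrite chi_class_rep in e2; exists c1, c2; split; [exact: e1 | exact: e2 |].
rewrite -class_diffB; last by rewrite e1 e2.
by rewrite {1}/class_diff scalerBr E1 E2.
Qed.

(** Modulo the differences, [class_elt c] depends only on [chi c]; so the quotient
carries a family indexed by exponents, and a combination that vanishes in the
fraction field vanishes in the quotient, all relations being binomial. *)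
Lemma ker_product_map (g : {linear M -> rscal f}) :
  (forall c, g (class_elt c) = X (chi c)) ->
  forall z, g z = 0 -> z \in class_diffs.
Proof.
move=> gE z gz.
pose y (w : G) : quotmod class_diffs := xget 0
  [set q | exists2 c : C, chi c = w & q = quotmod_pi class_diffs (class_elt c)].
have yE c : y (chi c) = quotmod_pi class_diffs (class_elt c).
  rewrite /y; case: xgetP => [q _ [c' e ->]|/(_ _ (ex_intro2 _ _ c erefl erefl))//].
  apply/quotmod_piE; rewrite class_diffB //.
  by apply: rpredB; apply: mem_lspan; [exists c'|exists c].
have Dst : stable (range (@chi G S A B)).
  by move=> s _ Ss [c _ <-]; have [c' e _] := class_elt_shift c Ss; exists c'.
have yc : compatible (range (@chi G S A B)) y.
  move=> s _ Ss [c _ <-]; have [c' e E] := class_elt_shift c Ss.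
  by rewrite -e !yE -linearZ E.
have [s _ zs] := lspan_family (class_elt_span z).
apply/quotmod_pi0.
have := S_binomial Dst yc (s := [seq (p.1, chi p.2) | p <- s]).
rewrite !big_map /= => H; rewrite zs linear_sum -[RHS]H.
- by apply: eq_bigr => p _; rewrite linearZ /= yE.
- by move=> p /mapP[q _ ->]; exists q.2.
- transitivity (g z); last exact: gz.
  rewrite zs linear_sum; apply: (@eq_bigr (rscal f)) => p _.
  by rewrite linearZ /= gE.
Qed.

Hypothesis (X0 : X 0 = 1).
Hypothesis SD : forall s s', S s -> S s' -> S (s + s').
Hypothesis A_in_group : forall a, A a -> exists2 s, S s & S (s + a).

Lemma X_neq0 a : X a != 0.
Proof.
apply/eqP => e; have := oner_neq0 K.
by rewrite -X0 -(subrr a) XD e mul0r eqxx.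
Qed.

Lemma mu_neq0 s : S s -> mu s != 0.
Proof.
by move=> Ss; apply: contraNneq (X_neq0 s) => e; rewrite -muE // e rmorph0.
Qed.

Lemma R_domain (r r' : R) : r != 0 -> r' != 0 -> r * r' != 0.
Proof.
move=> r0 r'0; rewrite -(inj_eq finj) rmorphM rmorph0 mulf_neq0 //.
  by rewrite -(rmorph0 f) (inj_eq finj).
by rewrite -(rmorph0 f) (inj_eq finj).
Qed.

(** Exponents of [A] differ from elements of [S] by elements of [S]. So two pairs
[(a, b)] and [(a', b')] with the same sum, once multiplied by suitable monomials,
can both be moved to the form [(s0, b0)] with one fixed [s0] in [A]; then [b0] is
determined by the sum. *)
Lemma class_diff_torsion c : torsion M (class_diff c).
Proof.
rewrite /torsion /= /class_diff.
have := chi_class_rep c; elim/class_rect: (class_rep c) => p'; elim/class_rect: c => p.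
have [Aa Bb] := rel_pairP p; have [Aa' Bb'] := rel_pairP p'.
rewrite !chiE !class_eltE.
move: (val p).1 (val p).2 (val p').1 (val p').2 Aa Bb Aa' Bb' => a b a' b' Aa Bb Aa' Bb' e.
have [s Ss Ssa] := A_in_group Aa; have [s' Ss' Ssa'] := A_in_group Aa'.
have As : A (s + a) by apply: Ast.
have key a1 b1 : A a1 -> B b1 -> S (s + s' + a1) ->
    (mu (s + a) * mu (s + s')) *: mon_tensor a1 b1 =
    mon_tensor (s + a) (s + s' + (a1 + b1)).
  move=> Aa1 Bb1 S1.
  rewrite -scalerA mon_tensorl //; last exact: SD.
  rewrite mon_tensorl //; last by apply: Ast => //; exact: SD.
  rewrite [s + a + _]addrC -(mon_tensorl S1 As Bb1).
  by rewrite (mon_tensorr S1 As Bb1) addrA.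
exists (mu (s + a) * mu (s + s')).
  by apply: R_domain; apply: mu_neq0 => //; apply: SD.
rewrite scalerBr !key //; first by rewrite e subrr.
  by rewrite -addrA; apply: SD.
by rewrite addrAC; apply: SD.
Qed.

Lemma torsion_class_diffs : torsion M = [set` class_diffs].
Proof.
apply/seteqP; split=> z /=.
  move=> [r r0 rz]; have [g gE] := product_map; apply: (ker_product_map gE).
  have := congr1 g rz; rewrite linearZ linear0 /= => /eqP.
  rewrite -[_ *: _]/(f _ * _) mulf_eq0 => /orP[|/eqP//].
  by rewrite -[X in _ == X](rmorph0 f) (inj_eq finj) (negPf r0).
move=> /lspan_family[s _ ->]; elim: s => [|p s [r r0 IH]].
  by exists 1; rewrite ?oner_neq0 // big_nil scaler0.
have [r' r'0 pr'] := class_diff_torsion p.2.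
exists (r * r'); first exact: R_domain.
have tail0 : (r * r') *: \sum_(q <- s) q.1 *: class_diff q.2 = 0.
  by rewrite mulrC -scalerA IH scaler0.
have head0 : (r * r') *: (p.1 *: class_diff p.2) = 0.
  by rewrite scalerA [r * r' * _]mulrAC -scalerA pr' scaler0.
by rewrite big_cons scalerDr head0 tail0 addr0.
Qed.

Hypothesis S0 : S 0.
Variable deg : G -> int.
Hypothesis degD : forall a b, deg (a + b) = deg a + deg b.
Hypothesis deg_gt0 : forall s, S s -> s != 0 -> 0 < deg s.

Definition mono_ideal : submodClosed R^o :=
  lspan [set (mu s : R^o) | s in [set s | S s /\ s != 0]].

Hypothesis mono_ideal_proper : (1 : R^o) \notin mono_ideal.
Hypothesis mono_ideal_residue : forall r : R,
  (r : R^o) \in mono_ideal \/ exists r', (r * r' - 1 : R^o) \in mono_ideal.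

Lemma deg0 : deg 0 = 0.
Proof. by apply: (addrI (deg 0)); rewrite -degD !addr0. Qed.

Lemma S_pointed s : S s -> S (- s) -> s = 0.
Proof.
move=> Ss SNs; apply/eqP; case: eqVneq => // s0.
have := deg_gt0 Ss s0; have := deg_gt0 SNs; rewrite oppr_eq0 => /(_ s0) h1 h2.
by have := addr_gt0 h1 h2; rewrite -degD addNr deg0.
Qed.

(** When [R] has a basis of monomials over a field, the quotient of [K] by this
submodule contains the graded dual of [R], with [X (- s)] dual to [X s]. *)
Definition codual : submodClosed (rscal f) :=
  lspan [set (X z : rscal f) | z in [set z | ~ S (- z)]].

(** Were 1 a combination of the [X z] with [- z] outside [S], the same relation
would hold in any compatible family. Take the family with values in [R] modulo its
monomial ideal that is 1 at exponent 0 and vanishes elsewhere: it gives that 1 is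
in the ideal. *)
Lemma one_notin_codual : (1 : rscal f) \notin codual.
Proof.
apply/negP => /expansion_lspan[s [sD e]].
pose D := [set z | S z \/ ~ S (- z)].
pose y (z : G) : quotmod mono_ideal := if z == 0 then quotmod_pi mono_ideal 1 else 0.
have Dst : stable D.
  move=> s' a Ss' [Sa|NSa]; [left; exact: SD | right=> H; apply: NSa].
  have -> : - a = s' + - (s' + a) by rewrite opprD addNKr.
  exact: SD.
have mu0 : mu 0 = 1 by apply: finj; rewrite muE // X0 rmorph1.
have yc : compatible D y.
  move=> s' a Ss' Da; rewrite /y; have [->|a0] := eqVneq a 0.
    rewrite addr0; have [->|s'0] := eqVneq s' 0; first by rewrite mu0 scale1r.
    rewrite -linearZ; apply/quotmod_pi0; rewrite /= -[_ *: _]/(_ * _) mulr1.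
    by apply: mem_lspan; exists s'.
  rewrite scaler0; case: eqP => // e1.
  have ea : a = - s' by apply/eqP; rewrite -addr_eq0 addrC e1.
  case: Da => [Sa|[]]; last by rewrite ea opprK.
  by move: a0; rewrite ea (S_pointed Ss') ?oppr0 ?eqxx // -ea.
have := S_binomial Dst yc (s := (-1, 0) :: s).
rewrite !big_cons /= -e X0 rmorphN1 mulr1 addNr => H.
have : quotmod_pi mono_ideal 1 = 0.
  apply/eqP; rewrite -oppr_eq0 -scaleN1r -[X in X == _]addr0.
  rewrite -[X in _ == X]H //; last first.
    by move=> p; rewrite inE => /predU1P[->|/sD]; [left|right].
  rewrite /y eqxx; apply/eqP; congr (_ + _); rewrite big_seq big1 // => p /sD NS.
  case: eqP => [e0|]; last by rewrite scaler0.
  by case: NS; rewrite e0 oppr0.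
by move/quotmod_pi0; apply/negP.
Qed.

Definition divides (c1 : C) a b := `[< exists s (p : rel_pairs A B),
  [/\ S s, val p = (s + a, b) & cls p = c1] >].

(** The functional sends [class_elt c] to [X (chi c - chi c1)] if [c] divides [c1],
and to 0 otherwise; these values are compatible because a multiple of a divisor of
[c1] that no longer divides [c1] is sent into [codual]. A class of degree at least
that of [c1] divides [c1] only if it is [c1]. *)
Lemma dual_functional (c1 : C) : exists g : {linear M -> quotmod codual},
  g (class_elt c1) != 0 /\
  forall c, deg (chi c1) <= deg (chi c) -> c != c1 -> g (class_elt c) = 0.
Proof.
pose eta a b := if divides c1 a b then quotmod_pi codual (X (a + b - chi c1)) else 0.
have etal s a b : S s -> A a -> B b -> mu s *: eta a b = eta (s + a) b.
  move=> Ss Aa Bb; rewrite /eta.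
  have [/asboolP[s' [p [Ss' pE pc]]]|nd] := boolP (divides c1 (s + a) b).
    rewrite ifT; last first.
      by apply/asboolP; exists (s' + s), p; rewrite -addrA; split=> //; apply: SD.
    rewrite -linearZ; congr quotmod_pi.
    by rewrite /= -[_ *: _]/(f _ * _) muE // -XD !addrA.
  case: ifP => [/asboolP[s' [p [Ss' pE pc]]]|_]; last by rewrite scaler0.
  rewrite -linearZ; apply/quotmod_pi0.
  rewrite /= -[_ *: _]/(f _ * _) muE // -XD.
  apply: mem_lspan; exists (s + (a + b - chi c1)) => // H.
  move/negP: nd; apply; apply/asboolP; exists (s' - s), p; split=> //.
    have <- : - (s + (a + b - (s' + a + b))) = s' - s.
      by rewrite -(addrA s') [- (s' + _)]opprD [a + b + _]addrCA subrr addr0 opprD opprK addrC.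
    by move: H; rewrite -pc chiE pE.
  by rewrite pE addrA subrK.
have div_switch s a b : S s -> A a -> B b -> divides c1 a (s + b) = divides c1 (s + a) b.
  move=> Ss Aa Bb; apply/asboolP/asboolP => -[s' [p [Ss' pE pc]]].
    have Ap : A (s' + (s + a)) by apply: Ast => //; apply: Ast.
    exists s', (rel_pair_of Ap Bb); split=> //; rewrite -pc; apply/eqmodP/asboolP.
    by apply: rst_step; exists (s' + a), b, s; split=> //=; rewrite addrCA.
  have Ap : A (s' + a) by apply: Ast.
  have Bp : B (s + b) by apply: Bst.
  exists s', (rel_pair_of Ap Bp); split=> //; rewrite -pc; apply/eqmodP/asboolP.
  by apply/rst_sym/rst_step; exists (s' + a), b, s; split=> //; rewrite pE addrCA.
have etar s a b : S s -> A a -> B b -> mu s *: eta a b = eta a (s + b).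
  by move=> Ss Aa Bb; rewrite etal // /eta div_switch // addrCA addrA.
have [g gE] := mon_tensor_lift etal etar.
exists g; split.
  elim/class_rect: c1 @eta etal div_switch etar gE => p eta _ _ _ gE.
  have [Aa Bb] := rel_pairP p; rewrite class_eltE gE // /eta ifT.
    rewrite chiE subrr X0; apply/eqP => /quotmod_pi0; apply/negP.
    exact: one_notin_codual.
  by apply/asboolP; exists 0, p; rewrite add0r -surjective_pairing.
elim/class_rect => p; have [Aa Bb] := rel_pairP p; rewrite class_eltE gE // chiE.
move=> le_deg ne; rewrite /eta; case: ifP => // /asboolP[s [q [Ss qE qc]]].
move: le_deg; rewrite -qc chiE qE /= -addrA (degD s) gerDr => le0.
have s0 : s = 0.
  by apply/eqP; case: eqVneq => // /(deg_gt0 Ss); rewrite ltNge le0.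
case/eqP: ne; rewrite -qc; congr (\pi_(_) _); apply: val_inj.
by rewrite qE s0 add0r -surjective_pairing.
Qed.

Definition le_deg (c c' : C) := deg (chi c) <= deg (chi c').

Lemma le_deg_trans : transitive le_deg.
Proof. by move=> c' c c''; apply: le_trans. Qed.

Lemma le_deg_refl : reflexive le_deg.
Proof. by move=> c; apply: lexx. Qed.

Definition class_diff_span (s : seq C) : submodClosed M := lspan [set class_diff c | c in [set` s]].

(** The filtration by the spans of the tails of the list, sorted by degree, has
simple or zero quotients. *)
Lemma chain_le_size (s : seq C) : (forall c, c != class_rep c -> c \in s) ->
  forall n (Ch : nat -> submodClosed M), {subset Ch n <= class_diffs} ->
    (forall i, (i < n)%N -> [set` Ch i] `<` [set` Ch i.+1]) -> (n <= size s)%N.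
Proof.
move=> sE n Ch Chn Chs; set e := sort le_deg s.
have eE c : c != class_rep c -> c \in e by move=> /sE; rewrite mem_sort.
rewrite -(size_sort le_deg s) -/e.
have e_sorted : sorted le_deg e.
  by apply: sort_sorted => c c'; apply: le_total.
apply: (@chain_bound _ _ (fun i => class_diff_span (drop i e))) Chs.
- move=> x; rewrite drop_size => /asboolP[m [a [g [gX ->]]]].
  by apply: big1 => i _; have [c] := gX i; rewrite /= in_nil.
- move=> i x y ie xF yF yF1.
  have [c0 _] : exists c : C, True by case: (e) ie => // c *; exists c.
  pose c := nth c0 e i.
  have head w : [set class_diff c' | c' in [set` drop i e]] w ->
      w = class_diff c \/ w \in class_diff_span (drop i.+1 e).
    move=> [c' /= ]; rewrite (drop_nth c0) // inE => /predU1P[->|c'e] <-; first by left.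
    by right; apply: mem_lspan; exists c'.
  have [r xr] := lspan_cons head xF; have [r' yr'] := lspan_cons head yF.
  have higher c' : deg (chi c) < deg (chi c') ->
      class_diff c' \in class_diff_span (drop i.+1 e).
    move=> lt_deg; have [eb|ne] := eqVneq c' (class_rep c').
      by rewrite eb class_diff_rep rpred0.
    apply: mem_lspan; exists c' => //=.
    have c'e := eE _ ne; move: (c'e); rewrite -{1}(cat_take_drop i.+1 e) mem_cat.
    rewrite in_take // ltnS => /orP[le_i|//].
    have := sorted_leq_nth le_deg_trans le_deg_refl c0 e_sorted.
    move=> /(_ (index c' e) i); rewrite !inE index_mem c'e => /(_ isT ie le_i).
    by rewrite nth_index // /le_deg -/c leNgt lt_deg.
  have mkill (u : R) : (u : R^o) \in mono_ideal ->
      u *: class_diff c \in class_diff_span (drop i.+1 e).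
    move=> /asboolP[m [a [g [gX ->]]]]; rewrite scaler_suml.
    apply: rpred_sum => j _; have [s' [Ss' s'0] <-] := gX j.
    rewrite -[_ *: (_ : R^o)]/(_ * _) -scalerA; apply: rpredZ.
    have [c1 [c2 [e1 e2 ->]]] := class_diff_shift c Ss'.
    by rewrite rpredB // higher // ?e1 ?e2 degD ltrDr deg_gt0.
  have [r'm|[r'' r''m]] := mono_ideal_residue r'.
    by case/negP: yF1; rewrite -(subrK (r' *: class_diff c) y) rpredD // mkill.
  exists (r * r'').
  have -> : x - (r * r'') *: y = (x - r *: class_diff c)
      - (r * r'') *: (y - r' *: class_diff c) - r *: ((r' * r'' - 1) *: class_diff c).
    move: (class_diff c) => z; rewrite !scalerBr scalerBl scale1r scalerBr !scalerA.
    rewrite -[r * r'' * r']mulrA [r'' * r']mulrC.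
    move: (_ *: y) ((r * (r' * r'')) *: z) (r *: z) => w q u.
    rewrite !opprB [x - u + _]addrC !addrA subrK.
    by rewrite [in RHS]addrC !addrA addNr add0r addrC.
  apply: rpredB; last by rewrite rpredZ // mkill.
  by apply: rpredB => //; apply: rpredZ.
- move=> x /Chn; apply: lspan_min => {}x [c _ <-]; rewrite drop0.
  have [eb|ne] := eqVneq c (class_rep c); first by rewrite eb class_diff_rep rpred0.
  by apply: mem_lspan; exists c => //; apply: eE.
Qed.
(** The functional attached to the class [c] of index [i] kills the later
differences, but not that of [c], since [class_rep c] differs from [c] and has the
same degree. *)
Lemma class_diff_independent (e : seq C) i c0 : uniq e -> sorted le_deg e ->
  (forall c, c \in e -> c != class_rep c) -> (i < size e)%N ->
  class_diff (nth c0 e i) \notin class_diff_span (drop i.+1 e).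
Proof.
move=> e_uniq e_sorted eE ie; set c := nth c0 e i.
have [g [gc g0]] := dual_functional c.
have ce : c \in e by apply: mem_nth.
apply/negP => /asboolP[m [a [h [hX bE]]]].
suff : g (class_diff c) = 0.
  rewrite /class_diff linearB /= (g0 (class_rep c)) ?chi_class_rep //; last by rewrite eq_sym eE.
  by rewrite subr0 => /eqP; rewrite (negPf gc).
rewrite bE linear_sum big1 // => j _; rewrite linearZ /=.
have [c' /= c'e <-] := hX j.
have le_c : deg (chi c) <= deg (chi c').
  have := sorted_leq_nth le_deg_trans le_deg_refl c0 e_sorted.
  move=> /(_ i (index c' e)); rewrite !inE index_mem (mem_drop c'e).
  move=> /(_ ie isT); rewrite nth_index ?(mem_drop c'e) //; apply.
  rewrite leqNgt; apply/negP => lt_i.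
  have := e_uniq; rewrite -{1}(cat_take_drop i.+1 e) cat_uniq => /and3P[_ /hasPn H _].
  by have := H _ c'e; rewrite in_take ?(mem_drop c'e) // ltnS ltnW.
rewrite /class_diff linearB /= !g0 ?chi_class_rep ?subrr ?scaler0 //.
  apply: contraNneq (eE _ ce) => eb.
  by rewrite -eb (class_rep_eq (chi_class_rep c')).
apply: contraTneq c'e => ->.
have := e_uniq; rewrite -{1}(cat_take_drop i.+1 e) cat_uniq => /and3P[_ /hasPn H _].
by apply/negP => /H; rewrite in_take // index_uniq // ltnSn.
Qed.

(** The spans of the tails of the sorted list form the chain, its top being
enlarged to all of the torsion. The last hypothesis makes the chain of length 0
correct: its bottom is then also its top. *)
Lemma chain_of_size (s : seq C) : uniq s -> (forall c, c \in s -> c != class_rep c) ->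
  (s = [::] -> forall c, c = class_rep c) ->
  exists Ch : nat -> submodClosed M, [/\ [set` Ch 0%N] = [set 0],
    [set` Ch (size s)] = [set` class_diffs]
    & forall i, (i < size s)%N -> [set` Ch i] `<` [set` Ch i.+1]].
Proof.
move=> s_uniq sE s_full; set e := sort le_deg s.
have e_uniq : uniq e by rewrite sort_uniq.
have eE c : c \in e -> c != class_rep c by rewrite mem_sort; apply: sE.
have e_sorted : sorted le_deg e by apply: sort_sorted => c c'; apply: le_total.
rewrite -(size_sort le_deg s) -/e; set N := size e.
pose Ch j : submodClosed M :=
  lspan [set class_diff c | c in [set c | j = N \/ c \in drop (N - j) e]].
exists Ch; split.
- apply/seteqP; split=> x /=; last by move=> ->; apply: rpred0.
  move=> /asboolP[m [a [h [hX ->]]]]; apply: big1 => j _.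
  have [c /= Dc <-] := hX j; rewrite subn0 drop_size in_nil in Dc.
  case: Dc => // N0; have s0 : s = [::].
    by apply/eqP; rewrite -size_eq0 -(size_sort le_deg s) -/e -/N -N0.
  by rewrite /class_diff -(s_full s0) subrr scaler0.
- apply/seteqP; split=> x /=; apply: lspan_le => _ [c _ <-]; exists c => //.
  by left.
move=> j jN; split.
  move=> x /=; apply: lspan_le => _ [c [jN'|ce] <-]; exists c => //=.
    by move: jN; rewrite jN' ltnn.
  right; move: ce; rewrite -subnSK // -add1n -drop_drop; exact: mem_drop.
have iN : (N - j.+1 < size e)%N by rewrite ltn_subrL /= (leq_trans _ jN).
have [c0 _] : exists c : C, True by case: (e) iN => // c *; exists c.
move=> H; have := class_diff_independent c0 e_uniq e_sorted eE iN.
have := H (class_diff (nth c0 e (N - j.+1))); rewrite /= subnSK // => Hb.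
case/negP; suff /Hb : class_diff (nth c0 e (N - j.+1)) \in Ch j.+1.
  apply: lspan_le => _ [c /= [jN'|ce] <-]; exists c => //.
  by move: jN; rewrite jN' ltnn.
apply: mem_lspan; exists (nth c0 e (N - j.+1)) => //=; right.
by rewrite (drop_nth c0) // mem_head.
Qed.

Lemma length_torsion (F : realType) :
  module_length F (torsion M) = counting [set c : C | c != class_rep c].
Proof.
rewrite /module_length torsion_class_diffs /counting.
set E := [set c : C | c != class_rep c]; set L := [set n | exists Ch, _].
have LP (s : seq C) : uniq s -> (forall c, c \in s -> c != class_rep c) ->
    (s = [::] -> forall c, c = class_rep c) -> L (size s).
  by move=> s1 s2 s3; have [Ch ?] := chain_of_size s1 s2 s3; exists Ch.
have Lle (s : seq C) n : (forall c, c != class_rep c -> c \in s) -> L n -> (n <= size s)%N.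
  move=> sE [Ch [_ Cn Cs]]; apply: (chain_le_size sE _ Cs) => x xC.
  by have : [set` Ch n] x by []; rewrite Cn.
case: asboolP => [Efin|Einf].
  apply/eqP; rewrite eq_le; apply/andP; split.
    apply: ge_ereal_sup => _ [n Ln <-]; rewrite lee_fin ler_nat.
    apply: Lle Ln => c cE; by rewrite in_fset_set // inE.
  apply: ereal_sup_ubound; exists #|` fset_set E|%fset => //.
  apply: LP => [|c|E0 c]; first exact: fset_uniq.
    by rewrite in_fset_set // inE.
  apply/eqP; apply/negPn/negP => cE.
  by have : c \in fset_set E by [rewrite in_fset_set // inE]; rewrite -[_ \in _]/(c \in enum_fset _) E0.
apply/eqyP => a a0.
have [n an] : exists n : nat, a <= n%:R.
  by exists (Num.bound a); rewrite ltW // archi_boundP // ltW.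
have [W WE Wn] := infinite_set_fset n.+1 Einf.
apply: le_trans (_ : (#|` W|%fset)%:R%:E <= _)%E.
  by rewrite lee_fin (le_trans an) // ler_nat (leq_trans _ Wn).
apply: ereal_sup_ubound; exists #|` W|%fset => //.
apply: LP; [exact: fset_uniq | by move=> c cW; apply: WE | ].
by move=> W0; move: Wn; rewrite /= W0.
Qed.

End Presented.
End Binomial.

(** * The invariant tau as a number of classes *)
Section Counting.
Variable F : realType.

Lemma counting_esum (T : choiceType) (Q : set T) :
  counting Q = (\esum_(i in Q) 1 : \bar F)%E.
Proof.
have fin_sum (W : set T) : finite_set W ->
    \sum_(i \in W) (1%:E : \bar F) = (#|` fset_set W|%fset)%:R%:E.
  move=> Wfin; rewrite fsbig_finite //= sumEFin; congr (_%:E).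
  by rewrite big_const_seq count_predT iter_addr_0.
rewrite /counting; case: asboolP => [Qfin|Qinf].
  by rewrite esum_fset // fin_sum.
symmetry; apply/eqyP => a a0.
have [n an] : exists n : nat, a <= n%:R.
  by exists (Num.bound a); rewrite ltW // archi_boundP // ltW.
have [W WE Wn] := infinite_set_fset n.+1 Qinf.
apply: esum_ge; exists [set` W]; first by split.
by rewrite fin_sum // lee_fin (le_trans an) // ler_nat set_fsetK (leq_trans _ Wn).
Qed.

Variables (G : zmodType) (S A B : set G).
Local Notation C := (rel_tensor S A B).

(** A nonempty fibre loses exactly one class, its representative; an empty one
accounts for the maximum with 0. *)
Lemma tau_atE (z : G) : tau_at S A B F z =
  counting ([set c : C | c != class_rep c] `&` @chi G S A B @^-1` [set z]).
Proof.
rewrite /tau_at; set P := @chi G S A B @^-1` [set z].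
have [P0|/set0P[c0 Pc0]] := eqVneq P set0.
  rewrite P0 setI0 /counting asboolT // fset_set0 /=.
  by rewrite -EFinB sub0r -EFin_max; congr (_%:E); apply/max_idPl; rewrite lerN10.
pose b := class_rep c0.
have Pb : P b by rewrite /P /preimage /= chi_class_rep.
have PD : [set c : C | c != class_rep c] `&` P = P `\ b.
  apply/seteqP; split=> [c [/= ne Pc]|c [Pc ne]]; split=> //=.
    move=> cb; case/eqP: ne; rewrite cb /b; apply: class_rep_eq.
    by rewrite chi_class_rep.
  apply/eqP => e; apply: ne; rewrite e /b.
  by apply: class_rep_eq; rewrite Pc Pc0.
rewrite PD /counting; case: asboolP => [Pfin|Pinf].
  rewrite asboolT; last exact: finite_setD.
  rewrite fset_setD1 // -EFinB -EFin_max; congr (_%:E).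
  rewrite (cardfsD1 b (fset_set P)) in_fset_set // mem_set // add1n.
  by rewrite -addn1 natrD addrK; apply/max_idPr.
rewrite asboolF; last first.
  by move=> fin; apply: Pinf; rewrite -(setD1K Pb) finite_setU; split.
by rewrite addye // max_r // leey.
Qed.

Lemma tau_counting : tau S A B F = counting [set c : C | c != class_rep c].
Proof.
rewrite counting_esum /tau.
pose D z := [set c : C | c != class_rep c] `&` @chi G S A B @^-1` [set z].
rewrite (eq_esum (b := fun z => \esum_(c in D z) (1%:E : \bar F))%E); last first.
  by move=> z _; rewrite tau_atE counting_esum.
rewrite esum_esum // (@reindex_esum _ _ _ [set c : C | c != class_rep c] _
  (fun c : C => (chi c, c))) //; split=> [c ne|c c' _ _ [_ //]|[z c] [_ [/= ne e]]].
  by split=> //; split.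
by exists c => //; rewrite e.
Qed.

End Counting.

(** * Torsion of a tensor product of monomial ideals *)

(** The functions [mu] and [deg] give the monomials as elements of [R] and a
positive grading of [S]. The two hypotheses on [mono_ideal] say that the monomials
of nonzero exponent generate a maximal ideal. *)
Theorem torsion_length_monomial (F : realType) (R : comNzRingType) (K : fieldType)
    (f : {rmorphism R -> K}) (G : zmodType) (S : set G) (X : G -> K) (mu : G -> R)
    (deg : G -> int) (A B : set G) (I J : submodClosed (rscal f)) :
  injective f -> X 0 = 1 -> (forall a b, X (a + b) = X a * X b) ->
  S 0 -> (forall s s', S s -> S s' -> S (s + s')) ->
  (forall s, S s -> f (mu s) = X s) ->
  (forall a b, deg (a + b) = deg a + deg b) ->
  (forall s, S s -> s != 0 -> 0 < deg s) ->
  (1 : R^o) \notin mono_ideal S mu ->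
  (forall r : R, (r : R^o) \in mono_ideal S mu \/
     exists r', (r * r' - 1 : R^o) \in mono_ideal S mu) ->
  binomial_relations f S X mu ->
  stable S A -> stable S B -> (forall a, A a -> exists2 s, S s & S (s + a)) ->
  I =i lspan [set (X a : rscal f) | a in A] ->
  J =i lspan [set (X b : rscal f) | b in B] ->
  module_length F (torsion (tensor (submod I) (submod J))) = tau S A B F.
Proof.
move=> finj X0 XD S0 SD muE degD deg_gt0 m1 mres bin Ast Bst Agrp IA JB.
rewrite tau_counting.
exact: (length_torsion bin Ast Bst finj XD muE
  (tensor_presents bin Ast Bst IA JB XD muE) X0 SD Agrp S0 degD deg_gt0 m1 mres).
Qed.

(** * Fractions and numerical semigroups *)
Section Fraction.
Variable R : idomainType.

Lemma fraction_repr (x : {fraction R}) :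
  exists a b : R, b != 0 /\ x = tofrac a / tofrac b.
Proof.
elim/quotW: x => r; exists (frac r).1, (frac r).2; split; first exact: denom_ratioP.
have b0 : tofrac (frac r).2 != 0 by rewrite tofrac_eq0 denom_ratioP.
apply: (mulIf b0); rewrite divfK //; unlock tofrac; rewrite -[LHS]FracField.pi_mul.
apply/eqmodP => /=; rewrite FracField.equivfE /FracField.mulf.
by rewrite !numden_Ratio ?mulr1 ?oner_neq0 ?denom_ratioP // mulrC.
Qed.

Lemma tofrac_inj : injective (@tofrac R).
Proof. by move=> x y /eqP; rewrite tofrac_eq => /eqP. Qed.

End Fraction.

Section NumericalSemigroup.
Variable (S : set int).
Hypotheses (S0 : S 0) (SD : forall a b, S a -> S b -> S (a + b)).

Lemma semigroup_mul a n : S a -> S (a *+ n).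
Proof.
move=> Sa; elim: n => [|n IH]; first by rewrite mulr0n.
by rewrite mulrS; apply: SD.
Qed.

(** For [g > 0] write [z] as [q g + r] with [r < g]; as [q >= g], this is
[(q - r) g + r (g + 1)]. *)
Lemma semigroup_conductor (g : int) : 0 <= g -> S g -> S (g + 1) ->
  forall z, g * g <= z -> S z.
Proof.
case: g => [g|g] // _ Sg Sg1 [z|z] // gz.
case: (posnP g) => [g0|g_gt0].
  by rewrite -[Posz z]natz; apply: semigroup_mul; rewrite g0 in Sg1.
have le_gq : (g <= z %/ g)%N by rewrite leq_divRL.
have lt_rg : (z %% g < g)%N by rewrite ltn_pmod.
have -> : Posz z = Posz g *+ (z %/ g - z %% g) + (Posz g + 1) *+ (z %% g).
  rewrite mulrnDl addrA -mulrnDr subnK ?(leq_trans (ltnW lt_rg)) //.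
  by rewrite natz -mulr_natr natz -PoszM -PoszD mulnC -divn_eq.
by apply: SD; apply: semigroup_mul.
Qed.
End NumericalSemigroup.

(** * Rings with a valuation whose maximal ideal is generated by powers of t *)
Section Valuation.
Variables (R : idomainType) (m : idealr R) (v : {fraction R} -> int).
Local Notation K := {fraction R}.
Hypothesis m_max : maximal_ideal m.
Hypothesis v_val : normalized_valuation v (@int_closure R).

(** Otherwise the ideal generated by [m] and [r] would be proper and larger than [m]. *)
Lemma maximal_residue (r : R) : r \in m \/ exists r', r * r' - 1 \in m.
Proof.
have [?|rNm] := boolP (r \in m); [by left | right].
apply: contrapT => no_inv.
pose Q : {pred R} := fun x => `[< exists b, x - r * b \in m >].
have Qcl : idealr_closed Q.
  split.
  - by apply/asboolP; exists 0; rewrite mulr0 subr0 idealr0.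
  - apply/asboolP => -[b Hb]; apply: no_inv; exists b.
    by rewrite -opprB rpredN.
  - move=> a x y /asboolP[b Hb] /asboolP[b' Hb']; apply/asboolP.
    exists (a * b + b').
    have -> : a * x + y - r * (a * b + b') = a * (x - r * b) + (y - r * b').
      by rewrite mulrBr mulrDr opprD addrACA mulrCA.
    by rewrite rpredD // idealMr.
pose QI : idealr R := HB.pack Q (isIdealr.Build R Q Qcl).
have mQ : {subset m <= QI}.
  by move=> x xm; apply/asboolP; exists 0; rewrite mulr0 subr0.
have rQ : r \in QI.
  by apply/asboolP; exists 1; rewrite mulr1 subrr idealr0.
by case/negP: rNm; rewrite -(m_max mQ).
Qed.

Lemma valM x y : x != 0 -> y != 0 -> v (x * y) = v x + v y.
Proof. by case: v_val => + _ _ _; apply. Qed.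

Lemma val1 : v 1 = 0.
Proof. by apply: (addrI (v 1)); rewrite -valM ?oner_neq0 // mulr1 addr0. Qed.

Lemma valV x : x != 0 -> v x^-1 = - v x.
Proof.
move=> x0; apply: (addrI (v x)); rewrite -valM ?invr_eq0 //.
by rewrite mulfV // val1 subrr.
Qed.

Lemma val_exp x (z : int) : x != 0 -> v (x ^ z) = v x * z.
Proof.
move=> x0; have nat_exp n : v (x ^+ n) = v x * n%:Z.
  elim: n => [|n IH]; first by rewrite expr0 val1 mulr0.
  by rewrite exprS valM ?expf_neq0 // IH -[n.+1%:Z]/(1 + n%:Z) mulrDr mulr1.
case: z => n; first exact: nat_exp.
by rewrite -[x ^ _]/((x ^+ n.+1)^-1) valV ?expf_neq0 // nat_exp NegzE mulrN.
Qed.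

(** The value of 0 is taken to be infinite. *)
Definition val_ge (p : int) (x : K) := (x == 0) || (p <= v x).

Lemma val_geD p x y : val_ge p x -> val_ge p y -> val_ge p (x + y).
Proof.
rewrite /val_ge => /predU1P[->|hx]; first by rewrite add0r.
case/predU1P=> [->|hy]; first by rewrite addr0 hx orbT.
have [->|x0] := eqVneq x 0; first by rewrite add0r hy orbT.
have [->|y0] := eqVneq y 0; first by rewrite addr0 hx orbT.
have [//|xy0] := eqVneq (x + y) 0.
case: v_val => _ /(_ x y x0 y0 xy0) h _ _.
by rewrite /= (le_trans _ h) // le_min hx.
Qed.

Lemma valN x : x != 0 -> v (- x) = v x.
Proof.
move=> x0; have N1 : (-1 : K) != 0 by rewrite oppr_eq0 oner_neq0.
have e : v (-1) + v (-1) = 0 by rewrite -valM // mulrNN mulr1 val1.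
rewrite -mulN1r valM //; suff -> : v (-1) = 0 by rewrite add0r.
by move: e; case: (v (-1)) => [[|n]|n].
Qed.

Lemma val_geN p x : val_ge p (- x) = val_ge p x.
Proof. by rewrite /val_ge oppr_eq0; case: eqVneq => //= x0; rewrite valN. Qed.

Lemma val_exact p x y : x != 0 -> v x = p -> val_ge (p + 1) y ->
  x + y != 0 /\ v (x + y) = p.
Proof.
move=> x0 vx hy.
have key : ~~ val_ge (p + 1) (x + y).
  apply/negP => h; have : val_ge (p + 1) x.
    by rewrite -(addrK y x); apply: val_geD; rewrite ?val_geN.
  by rewrite /val_ge (negPf x0) vx gerDl.
have : val_ge p (x + y).
  apply: val_geD; first by rewrite /val_ge vx lexx orbT.
  by case/predU1P: hy => [->|hy]; rewrite /val_ge ?eqxx // (le_trans _ hy) ?orbT // lerDl.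
move: key; rewrite /val_ge negb_or => /andP[xy0]; rewrite (negPf xy0) /= -ltNge => lt le.
by split=> //; apply/eqP; rewrite eq_le le andbT -ltzD1.
Qed.

Lemma val_geM p q x y : val_ge p x -> val_ge q y -> val_ge (p + q) (x * y).
Proof.
rewrite /val_ge mulf_eq0; case: eqVneq => //= x0 hx; case: eqVneq => //= y0 hy.
by rewrite valM // lerD.
Qed.

Lemma val_ge_sum p (T : Type) (s : seq T) (P : pred T) (g : T -> K) :
  (forall i, P i -> val_ge p (g i)) -> val_ge p (\sum_(i <- s | P i) g i).
Proof.
move=> gp; apply: (big_ind (val_ge p)) => //; last by move=> *; apply: val_geD.
by rewrite /val_ge eqxx.
Qed.

Lemma val_ring (r : R) : val_ge 0 (tofrac r).
Proof.
rewrite /val_ge; case: eqVneq => //= r0; case: v_val => _ _ _ /(_ _ r0)[+ _]; apply.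
exact: integral_id.
Qed.

(** If [r] had value 0, its inverse would be integral over [R]; clearing the
denominators of an equation of integral dependence gives that 1 is a multiple of
[r]. *)
Lemma val_maximal_gt0 r : r \in m -> val_ge 1 (tofrac r).
Proof.
move=> rm; rewrite /val_ge; case: eqVneq => //= r0.
have := val_ring r; rewrite /val_ge (negPf r0) /= le_eqVlt => /predU1P[v0|//].
have rV0 : (tofrac r)^-1 != 0 by rewrite invr_eq0.
have [p p_monic] : integralOver (@tofrac R) (tofrac r)^-1.
  by case: v_val => _ _ _ /(_ _ rV0)[_]; apply; rewrite valV // -v0.
rewrite /root => /eqP pr0; have szp := polySpred (monic_neq0 p_monic).
move: (size p).-1 szp => n szp.
suff /eqP e : 1 + \sum_(i < n) p`_i * r ^+ (n - i) == 0.
  have := idealr1 m; rewrite -(addrK (\sum_(i < n) p`_i * r ^+ (n - i)) 1).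
  rewrite e sub0r rpredN rpred_sum // => i _.
  by apply: idealMr; rewrite -(subnSK (ltn_ord i)) exprSr; apply: idealMr.
rewrite -(inj_eq (@tofrac_inj R)) rmorphD rmorph1 rmorph_sum rmorph0.
have := congr1 (fun x => x * tofrac r ^+ n) pr0.
rewrite mul0r horner_coef size_map_poly_id0; last first.
  by rewrite (monicP p_monic) rmorph1 oner_neq0.
rewrite szp big_ord_recr /= mulrDl => E; apply/eqP.
rewrite -[RHS]E [LHS]addrC; congr (_ + _).
  rewrite big_distrl; apply: eq_bigr => i _ /=.
  rewrite coef_map rmorphM rmorphXn /= -mulrA; congr (_ * _).
  by rewrite exprVn mulrC -expfB // ltnW.
rewrite coef_map /=; have -> : p`_n = 1 by rewrite -(monicP p_monic) /lead_coef szp.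
rewrite rmorph1 mul1r.
by rewrite exprVn mulVf // expf_neq0.
Qed.

Lemma val_unit r : r \notin m -> tofrac r != 0 /\ v (tofrac r) = 0.
Proof.
move=> rNm; case: (maximal_residue r) => [|[r' r'm]]; first by rewrite (negPf rNm).
have r0 : tofrac r != 0.
  by rewrite tofrac_eq0; apply: contraNneq rNm => ->; rewrite idealr0.
split=> //; apply/eqP/negPn/negP => vr.
have hr : val_ge 1 (tofrac r).
  by have := val_ring r; rewrite /val_ge (negPf r0) /= -gtz0_ge1 lt_neqAle eq_sym vr.
have : val_ge 1 (1 : K).
  have -> : (1 : K) = tofrac r * tofrac r' - tofrac (r * r' - 1).
    by rewrite rmorphB rmorphM rmorph1 opprB addrC subrK.
  apply: val_geD; last by rewrite val_geN val_maximal_gt0.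
  by rewrite -[1]addr0; apply: val_geM => //; apply: val_ring.
by rewrite /val_ge oner_eq0 val1.
Qed.

Variables (t : K) (e : nat) (d : 'I_e -> nat).
Hypothesis m_gen : [set tofrac r | r in [set` m]] =
  [set` lspan [set x : frac_mod R | exists i, x = t ^+ d i]].

Lemma mem_maximal_lspan r : r \in m <-> tofrac r \in lspan [set x : frac_mod R | exists i, x = t ^+ d i].
Proof.
split=> [rm|h].
  have : [set tofrac r | r in [set` m]] (tofrac r) by exists r.
  by rewrite m_gen.
have : [set` lspan [set x : frac_mod R | exists i, x = t ^+ d i]] (tofrac r) by [].
by rewrite -m_gen => -[r' r'm /tofrac_inj <-].
Qed.

Lemma maximal_generator i : exists2 r, r \in m & tofrac r = t ^+ d i.
Proof.
have : [set` lspan [set x : frac_mod R | exists i, x = t ^+ d i]] (t ^+ d i).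
  by apply: mem_lspan; exists i.
by rewrite -m_gen => -[r rm <-]; exists r.
Qed.

(** The valuation being onto, [m] is not zero, so some power of [t] with exponent
[d i] is a nonzero element of [m], and thus has positive value. *)
Lemma generator_facts : [/\ t != 0, 0 < v t & forall i, (0 < d i)%N].
Proof.
have [x x0 vx] : exists2 x, x != 0 & v x = 1 by case: v_val.
have [a [b [b0 xE]]] := fraction_repr x.
have a0 : a != 0 by apply: contraNneq x0 => a0; rewrite xE a0 rmorph0 mul0r.
have [r rm r0] : exists2 r, r \in m & r != 0.
  have [am|/val_unit[_ va]] := boolP (a \in m); first by exists a.
  have [bm|/val_unit[_ vb]] := boolP (b \in m); first by exists b.
  by move: vx; rewrite xE valM ?invr_eq0 ?tofrac_eq0 // valV ?tofrac_eq0 // va vb.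
have d_gt0 i : (0 < d i)%N.
  rewrite lt0n; apply/eqP => di0; have [r' r'm] := maximal_generator i.
  by rewrite di0 expr0 -[1](rmorph1 (@tofrac R)) => /tofrac_inj r'1; move: r'm; rewrite r'1 idealr1.
have [i ti0] : exists i, t ^+ d i != 0.
  apply: contrapT => H; have /mem_maximal_lspan/asboolP[n [c [g [gX E]]]] := rm.
  move: r0; rewrite -tofrac_eq0 E big1 ?eqxx // => j _.
  have [i gE] := gX j; have [gj0|/negP gj0] := boolP (g j == 0).
    by rewrite (eqP gj0) scaler0.
  by case: H; exists i; rewrite -gE; apply/negP.
have t0 : t != 0 by move: ti0; rewrite expf_eq0 d_gt0.
split=> //; have [r' r'm r'E] := maximal_generator i.
have := val_maximal_gt0 r'm; rewrite r'E /val_ge (negPf ti0) /=.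
rewrite -[t ^+ _]/(t ^ (d i)%:Z) val_exp // => h.
have := lt_le_trans ltr01 h; rewrite pmulr_lgt0 //.
by rewrite ltz_nat d_gt0.
Qed.

Definition gen_semigroup : set int := [set z | exists s : seq 'I_e,
  z = (\sum_(i <- s) d i)%N%:Z].
Local Notation Gam := gen_semigroup.

Definition t_lift (z : int) : R := xget 0 [set r | tofrac r = t ^ z].

Lemma gen_semigroup0 : Gam 0.
Proof. by exists [::]; rewrite big_nil. Qed.

Lemma gen_semigroupD a b : Gam a -> Gam b -> Gam (a + b).
Proof. by move=> [s ->] [s' ->]; exists (s ++ s'); rewrite big_cat. Qed.

Lemma gen_semigroup_ge0 a : Gam a -> 0 <= a.
Proof. by case=> s ->. Qed.

Lemma gen_semigroup_gen i : Gam (d i)%:Z.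
Proof. by exists [:: i]; rewrite big_seq1. Qed.

Lemma t_liftE z : Gam z -> tofrac (t_lift z) = t ^ z.
Proof.
move=> [s ->]; rewrite /t_lift; case: xgetP => [r _ //|H].
have [r rE] : exists r, tofrac r = t ^+ (\sum_(i <- s) d i)%N.
  elim: s {H} => [|i s [r IH]]; first by exists 1; rewrite big_nil rmorph1.
  have [r' _ r'E] := maximal_generator i; exists (r' * r).
  by rewrite tofracM big_cons exprD r'E IH.
by case: (H r).
Qed.

Lemma t_expD a b : t ^ (a + b) = t ^ a * t ^ b.
Proof. by have [t0 _ _] := generator_facts; rewrite expfzDr. Qed.

Lemma t_exp_neq0 a : t ^ a != 0.
Proof. by have [t0 _ _] := generator_facts; rewrite expfz_neq0. Qed.

Lemma val_t_exp a : v (t ^ a) = v t * a.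
Proof. by have [t0 _ _] := generator_facts; rewrite val_exp. Qed.

Lemma maximal_expansion (r : R) : r \in m -> exists n (a : 'I_n -> R) (g : 'I_n -> 'I_e),
  r = \sum_(j < n) a j * t_lift (d (g j)).
Proof.
move=> /mem_maximal_lspan/asboolP[n [a [x [xX E]]]].
pose g j := sval (cid (xX j)); have gE j : x j = t ^+ d (g j) by rewrite /g; case: cid.
exists n, a, g; apply: tofrac_inj; rewrite E rmorph_sum; apply: eq_bigr => j _.
rewrite /= tofracM t_liftE; last exact: gen_semigroup_gen.
by rewrite gE.
Qed.

(** Each monomial is paired with its image in a compatible family, so that an
expansion of an element of the fraction field and the corresponding combination in
[P] are rewritten at the same time. *)
Section Filtration.
Variables (P : lmodType R) (D : set int) (y : int -> P).
Hypothesis Dst : stable Gam D.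
Hypothesis yc : compatible Gam t_lift D y.

Definition gen_pair (a : int) : (frac_mod R * P)%type := ((t ^ a : frac_mod R), y a).

Lemma gen_pair_shift s a : Gam s -> D a ->
  t_lift s *: gen_pair a = gen_pair (s + a).
Proof.
move=> Gs Da; apply: injective_projections => /=; last by rewrite yc.
by rewrite t_expD -(t_liftE Gs).
Qed.

Definition filt (p : int) : submodClosed (frac_mod R * P)%type :=
  lspan [set gen_pair a | a in D `&` [set a | p <= a]].

Lemma filt_val p w : w \in filt p -> val_ge (v t * p) w.1.
Proof.
have [t0 vt0 _] := generator_facts.
move=> /asboolP[n [a [g [gX ->]]]].
have -> : (\sum_(i < n) a i *: g i).1 = \sum_(i < n) tofrac (a i) * (g i).1.
  exact: (raddf_sum (@fst (frac_mod R) P)).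
apply: val_ge_sum => i _; have [b [Db pb] <-] := gX i.
rewrite -[X in val_ge X]add0r; apply: val_geM; first exact: val_ring.
by rewrite /val_ge /= val_t_exp ler_pM2l // pb orbT.
Qed.

(** Separate the term [r X p] from those of larger exponent. If [r] is a unit, this
term alone determines the value. If [r] is in [m], expanding it in the generators
[t^d] of [m] turns this term into monomials of larger exponent. *)
Lemma filt_step p w : w \in filt p ->
  [/\ D p, w.1 != 0 & v w.1 = v t * p] \/ w \in filt (p + 1).
Proof.
have [t0 vt0 d0] := generator_facts.
move=> wF; have [Dp|NDp] := pselect (D p); last first.
  right; apply: lspan_le wF => _ [a [Da pa] <-]; exists a => //; split=> //=.
  rewrite -ltzD1 ltrD2r lt_neqAle pa andbT.
  by apply/eqP => pE; apply: NDp; rewrite pE.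
have [r wr] : exists r, w - r *: gen_pair p \in filt (p + 1).
  apply: lspan_cons wF => _ [a [Da pa] <-].
  have [->|ap] := eqVneq a p; [by left | right].
  by apply: mem_lspan; exists a => //; split=> //=; rewrite -ltzD1 ltrD2r lt_neqAle eq_sym ap.
have [/maximal_expansion[n [a [g rE]]]|/val_unit[r0 vr]] := boolP (r \in m).
  right; rewrite -(subrK (r *: gen_pair p) w) rpredD // rE scaler_suml.
  apply: rpred_sum => j _; rewrite -scalerA rpredZ // gen_pair_shift //; last exact: gen_semigroup_gen.
  apply: mem_lspan; exists ((d (g j))%:Z + p) => //.
  split; first by apply: Dst => //; apply: gen_semigroup_gen.
  by rewrite /= [p + 1]addrC lerD2r lez_nat d0.
left; have := filt_val wr; rewrite mulrDr mulr1 => hw.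
have rt0 : tofrac r * t ^ p != 0 by rewrite mulf_neq0 ?t_exp_neq0.
have vrt : v (tofrac r * t ^ p) = v t * p by rewrite valM ?t_exp_neq0 // vr add0r val_t_exp.
have [] := @val_exact (v t * p) (tofrac r * t ^ p) (w - r *: gen_pair p).1 rt0 vrt.
  move: hw; rewrite /val_ge => /predU1P[->|hw]; first by rewrite eqxx.
  by rewrite (le_trans _ hw) ?orbT // lerD2l -gtz0_ge1.
have -> : tofrac r * t ^ p + (w - r *: gen_pair p).1 = w.1.
  by rewrite /= addrC; apply: subrK.
by split.
Qed.

Lemma filt_descend p w : w \in filt p ->
  (exists a, [/\ D a, w.1 != 0 & v w.1 = v t * a]) \/ forall k : nat, w \in filt (p + k%:Z).
Proof.
move=> wF; have [H|H] := pselect (exists a, [/\ D a, w.1 != 0 & v w.1 = v t * a]).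
  by left.
right; elim=> [|k IH]; first by rewrite addr0.
case: (filt_step IH) => [ww|]; first by case: H; eexists; apply: ww.
by rewrite -addrA -PoszD addn1.
Qed.

Lemma expansion_filt (s : seq (R * int)) : (forall p, p \in s -> D p.2) ->
  exists p, \sum_(q <- s) q.1 *: gen_pair q.2 \in filt p.
Proof.
elim: s => [|q s IH] sD; first by exists 0; rewrite big_nil rpred0.
have [|p pF] := IH; first by move=> p ps; apply: sD; rewrite inE ps orbT.
exists (Num.min q.2 p); rewrite big_cons rpredD //.
  apply: rpredZ; apply: mem_lspan; exists q.2 => //; split=> /=.
    by apply: sD; rewrite mem_head.
  by rewrite ge_min lexx.
apply: lspan_le pF => _ [a [Da pa] <-]; exists a => //; split=> //=.
by rewrite ge_min pa orbT.
Qed.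

Lemma expansion_val (s : seq (R * int)) : (forall p, p \in s -> D p.2) ->
  \sum_(q <- s) tofrac q.1 * t ^ q.2 != 0 ->
  exists2 a, D a & v (\sum_(q <- s) tofrac q.1 * t ^ q.2) = v t * a.
Proof.
move=> sD x0; have [p wF] := expansion_filt sD.
have wE : (\sum_(q <- s) q.1 *: gen_pair q.2).1 = \sum_(q <- s) tofrac q.1 * t ^ q.2.
  exact: (raddf_sum (@fst (frac_mod R) P)).
have [t0 vt0 _] := generator_facts.
move: wE x0; set x := \sum_(q <- s) _ * _ => wE x0.
case: (filt_descend wF) => [[a [Da _ va]]|/(_ (`|p| + `|v x| + 1)%N) wk].
  by exists a; rewrite // -wE.
have := filt_val wk; rewrite wE /val_ge (negPf x0) /=; nia.
Qed.

End Filtration.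

Lemma expansion_val_semigroup (D : set int) (s : seq (R * int)) : stable Gam D ->
  (forall p, p \in s -> D p.2) -> \sum_(q <- s) tofrac q.1 * t ^ q.2 != 0 ->
  exists2 a, D a & v (\sum_(q <- s) tofrac q.1 * t ^ q.2) = v t * a.
Proof.
move=> Dst; apply: (@expansion_val R^o D (fun=> 0)) => // s' a _ _.
by rewrite scaler0.
Qed.

Lemma val_ring_semigroup (r : R) : r != 0 -> exists2 a, Gam a & v (tofrac r) = v t * a.
Proof.
move=> r0.
have [] := @expansion_val_semigroup Gam [:: (r, 0)].
- by move=> a b; apply: gen_semigroupD.
- by move=> p; rewrite inE => /eqP->; apply: gen_semigroup0.
- by rewrite big_seq1 expr0z mulr1 tofrac_eq0.
by move=> a Ga; rewrite big_seq1 expr0z mulr1; exists a.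
Qed.

(** An element of value 1 is a quotient of two elements of [R], with values [v t * g]
and [v t * h] for [g] and [h] in the semigroup generated by the [d i]. So
[v t * (g - h) = 1]. *)
Lemma consecutive_values : v t = 1 /\ exists2 g, Gam g & Gam (g + 1).
Proof.
have [t0 vt0 _] := generator_facts.
have [x x0 vx] : exists2 x, x != 0 & v x = 1 by case: v_val.
have [a [b [b0 xE]]] := fraction_repr x.
have a0 : a != 0 by apply: contraNneq x0 => a0; rewrite xE a0 rmorph0 mul0r.
have [g Gg va] := val_ring_semigroup a0; have [h Gh vb] := val_ring_semigroup b0.
have vgh : v t * (g - h) = 1.
  by rewrite mulrBr -va -vb -vx xE valM ?invr_eq0 ?tofrac_eq0 // valV ?tofrac_eq0.
have gh0 : 0 < g - h by rewrite -(pmulr_rgt0 _ vt0) vgh.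
have vt1 : v t = 1.
  apply/eqP; rewrite eq_le -gtz0_ge1 vt0 andbT -vgh -[leLHS]mulr1.
  by rewrite ler_pM2l // -gtz0_ge1.
by split=> //; exists h => //; rewrite -vgh vt1 mul1r addrC subrK.
Qed.

Lemma val_t1 : v t = 1. Proof. by have [] := consecutive_values. Qed.

Lemma gen_semigroup_conductor : exists N : int, forall z : int, N <= z -> Gam z.
Proof.
have [_ [g Gg Gg1]] := consecutive_values; exists (g * g).
exact: (semigroup_conductor gen_semigroup0 gen_semigroupD (gen_semigroup_ge0 Gg) Gg Gg1).
Qed.

Lemma value_semigroup : value_set v (range (@tofrac R)) = Gam.
Proof.
apply/seteqP; split=> [_ [_ [[r _ <-] r0] <-]|z Gz].
  move: r0; rewrite tofrac_eq0 => /val_ring_semigroup[a Ga ->].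
  by rewrite val_t1 mul1r.
exists (t ^ z); last by rewrite val_t_exp val_t1 mul1r.
by split; [exists (t_lift z); rewrite ?t_liftE | exact: t_exp_neq0].
Qed.

Lemma valuation_binomial :
  binomial_relations (@tofrac R) Gam (fun z => t ^ z) t_lift.
Proof.
move=> D P y Dst yc s sD s0; have [N NG] := gen_semigroup_conductor.
case: s sD s0 => [|p0 s'] sD s0; first by rewrite big_nil.
move: sD s0; set s := p0 :: s' => sD s0.
have Dp0 : D p0.2 by apply: sD; rewrite mem_head.
have [p wF] := expansion_filt y sD.
move: wF; set w := \sum_(q <- s) _ *: gen_pair y _ => wF.
have w1 : w.1 = 0.
  by rewrite -s0; exact: (raddf_sum (@fst (frac_mod R) P)).
have w2 : w.2 = \sum_(q <- s) q.1 *: y q.2.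
  exact: (raddf_sum (@snd (frac_mod R) P)).
rewrite -w2.
case: (filt_descend Dst yc wF) => [[a []]|/(_ (`|p| + `|N| + `|p0.2|)%N) wk].
  by rewrite w1 eqxx.
(* Beyond the conductor every generator is a multiple of the one at [p0.2]. *)
have far (a b : int) : p + (`|p| + `|N| + `|b|)%N%:Z <= a -> N <= a - b by lia.
have : w \in lspan [set gen_pair y p0.2].
  apply: lspan_min wk => _ [a [Da /= pa] <-].
  rewrite -(subrK p0.2 a) -(gen_pair_shift yc) //; last exact/NG/far.
  by apply: rpredZ; apply: mem_lspan.
move=> /(lspan_cons (d := gen_pair y p0.2) (N := lspan set0))[|r].
  by move=> _ ->; left.
move=> /asboolP[[|n] [a [g [gX]]]]; last by case: (gX ord0).
rewrite big_ord0 => /eqP; rewrite subr_eq0 => /eqP wE.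
move: w1; rewrite wE /= => /eqP; rewrite -[_ *: _]/(tofrac r * _).
rewrite mulf_eq0 (negPf (t_exp_neq0 _)) orbF tofrac_eq0 => /eqP->.
by rewrite scale0r.
Qed.

Section Ideals.
Variables (I : submodClosed (frac_mod R)) (h : nat) (z : 'I_h -> int).
Hypothesis I_gen : I =i lspan [set x : frac_mod R | exists i, x = t ^ z i].

Definition ideal_values : set int := [set a | exists i, Gam (a - z i)].

Lemma ideal_values_stable : stable Gam ideal_values.
Proof. by move=> s a Gs [i Gi]; exists i; rewrite -addrA; apply: gen_semigroupD. Qed.

Lemma ideal_span : I =i lspan [set (t ^ a : frac_mod R) | a in ideal_values].
Proof.
move=> x; rewrite I_gen; apply/idP/idP; last first.
  apply: lspan_min => _ [a [i Gi] <-]; rewrite -(subrK (z i) a) t_expD -t_liftE //.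
  by apply: (rpredZ (t_lift (a - z i))); apply: mem_lspan; exists i.
by apply: lspan_le => _ [i ->]; exists (z i) => //; exists i; rewrite subrr; apply: gen_semigroup0.
Qed.

Lemma value_ideal : value_set v [set` I] = ideal_values.
Proof.
apply/seteqP; split=> [_ [x [xI x0] <-]|a aA].
  have : x \in lspan [set (t ^ a : frac_mod R) | a in ideal_values].
    by rewrite -ideal_span.
  move=> /lspan_family[s sA xE]; rewrite xE in x0 *.
  have [a Aa ->] := expansion_val_semigroup ideal_values_stable sA x0.
  by rewrite val_t1 mul1r.
exists (t ^ a); last by rewrite val_t_exp val_t1 mul1r.
split; last exact: t_exp_neq0.
by rewrite /= ideal_span; apply: mem_lspan; exists a.
Qed.

Lemma ideal_values_group a : ideal_values a -> exists2 s, Gam s & Gam (s + a).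
Proof.
move=> _; have [N NG] := gen_semigroup_conductor.
by exists (`|N| + `|a|); apply: NG; lia.
Qed.

End Ideals.

(** Monomials of positive exponent have positive value, and elements outside [m]
have value 0. *)
Lemma mono_ideal_maximal : mono_ideal Gam t_lift =i m.
Proof.
have [_ _ d0] := generator_facts.
move=> r; apply/idP/idP => [/asboolP[n [a [g [gX ->]]]]|/maximal_expansion[n [a [g ->]]]].
  apply: rpred_sum => i _; apply: idealMr; have [s [Gs s0] <-] := gX i.
  apply/negPn/negP => /val_unit[_]; rewrite t_liftE // val_t_exp val_t1 mul1r => se.
  by rewrite se eqxx in s0.
apply: rpred_sum => j _; apply: (@rpredZ R R^o (mono_ideal Gam t_lift)).
apply: mem_lspan; exists (d (g j))%:Z => //; split; first exact: gen_semigroup_gen.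
by rewrite eqz_nat -lt0n.
Qed.

Theorem valuation_torsion_length (F : realType) (I J : submodClosed (frac_mod R)) :
  monomial_fractional_ideal t I -> monomial_fractional_ideal t J ->
  module_length F (torsion (tensor (submod I) (submod J))) =
    tau (value_set v (range (@tofrac R)))
        (value_set v [set` I]) (value_set v [set` J]) F.
Proof.
move=> [h [z Iz]] [h' [z' Jz]].
rewrite value_semigroup (value_ideal Iz) (value_ideal Jz).
apply: (@torsion_length_monomial _ _ _ _ _ _ (fun z => t ^ z) t_lift id).
- exact: tofrac_inj.
- exact: expr0z.
- exact: t_expD.
- exact: gen_semigroup0.
- exact: gen_semigroupD.
- exact: t_liftE.
- by [].
- by move=> s /gen_semigroup_ge0 s_ge0 s0; rewrite lt_neqAle eq_sym s0.
- by rewrite mono_ideal_maximal idealr1.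
- by move=> r; rewrite mono_ideal_maximal; case: (maximal_residue r) => [|[r' H]];
    [left | right; exists r'; rewrite mono_ideal_maximal].
- exact: valuation_binomial.
- exact: ideal_values_stable.
- exact: ideal_values_stable.
- exact: ideal_values_group.
- exact: ideal_span.
- exact: ideal_span.
Qed.

End Valuation.

(** * Leading exponents and Laurent monomials *)
Section LeadExp.
Variables (k : fieldType) (n : nat) (le : rel 'X_{1..n}).
Local Notation P := {mpoly k[n]}.
Hypothesis le_ord : monomial_order le.

Lemma lead_exp_unique (f : P) a b : lead_exp le f a -> lead_exp le f b -> a = b.
Proof.
case: le_ord => [[_ anti _ _] _] [af fa] [bf fb].
by apply: anti; rewrite fb // fa.
Qed.

Lemma lead_exp_exists (f : P) : f != 0 -> exists a, lead_exp le f a.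
Proof.
case: le_ord => [[refl _ tr tot] _].
rewrite -msupp_eq0 /lead_exp; elim: (msupp f) => [//|a s IH] _.
have [->|/IH[b [bs sb]]] := eqVneq s [::].
  by exists a; split=> [|b]; rewrite inE // => /eqP->.
have /orP[ab|ba] := tot a b.
  exists b; split; first by rewrite inE bs orbT.
  by move=> c; rewrite inE => /predU1P[->//|/sb].
exists a; split; first by rewrite mem_head.
by move=> c; rewrite inE => /predU1P[->//|/sb cb]; apply: tr cb ba.
Qed.

Lemma lead_exp_mul (f g : P) a b :
  lead_exp le f a -> lead_exp le g b -> lead_exp le (f * g) (a + b)%MM.
Proof.
case: le_ord => [[refl anti tr tot] [_ leD]] [af fa] [bg gb].
have leDr c d e : le c d -> le (e + c)%MM (e + d)%MM.
  by move=> cd; rewrite ![(e + _)%MM]addmC; apply: leD.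
split.
  rewrite mcoeff_msupp mpolyME raddf_sum /= (bigD1_seq (a, b)) /=; last first.
  - by apply: allpairs_uniq; rewrite ?msupp_uniq // => -[? ?] [].
  - by apply/allpairsP; exists (a, b).
  rewrite mcoeffZ mcoeffX eqxx mulr1 big_seq_cond big1 => [|[c d] /= /andP[]].
    by rewrite addr0 mulf_neq0 // -mcoeff_msupp.
  move=> /allpairsP[[c' d'] /= [cf dg [-> ->]]] ne.
  rewrite mcoeffZ mcoeffX; case: eqP => [e|]; last by rewrite mulr0.
  have ca := fa _ cf; have db := gb _ dg.
  have e1 : (a + d' = a + b)%MM.
    by apply: anti; rewrite leDr // -e leD.
  have dE : d' = b by apply: addmI e1.
  have cE : c' = a by apply: (@addIm _ b); rewrite -e dE.
  by move: ne; rewrite cE dE eqxx.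
move=> c /msuppM_le/allpairsP[[d d'] /= [df dg ->]].
by apply: tr (leD _ _ _ (fa _ df)) (leDr _ _ _ (gb _ dg)).
Qed.

Lemma lead_expX a : lead_exp le ('X_[a] : P) a.
Proof.
case: le_ord => [[refl _ _ _] _].
by split=> [|b]; rewrite msuppX inE // => /eqP->.
Qed.

Lemma lead_exp_neq0 (f : P) a : lead_exp le f a -> f != 0.
Proof. by move=> [af _]; rewrite -msupp_eq0; case: (msupp f) af. Qed.

End LeadExp.

Section Laurent.
Variables (k : fieldType) (n : nat).
Local Notation P := {mpoly k[n]}.
Local Notation K := {fraction P}.
Local Notation Z := 'rV[int]_n.
Local Notation X := (@laurent k n).

Definition exponent (a : 'X_{1..n}) : Z := \row_i (a i)%:Z.

Lemma exponent_inj : injective exponent.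
Proof.
move=> a b /rowP ab; apply/mnmP => i; have := ab i; rewrite !mxE.
by case.
Qed.

Lemma exponentD a b : exponent (a + b)%MM = exponent a + exponent b.
Proof. by apply/rowP => i; rewrite !mxE mnmDE PoszD. Qed.

Lemma exponent0 : exponent 0%MM = 0.
Proof. by apply/rowP => i; rewrite !mxE mnm0E. Qed.

Lemma tofracX_neq0 (a : 'X_{1..n}) : tofrac ('X_[a] : P) != 0.
Proof. by rewrite tofrac_eq0 -msupp_eq0 msuppX. Qed.

Lemma laurent0 : X 0 = 1.
Proof. by rewrite /laurent big1 // => i _; rewrite mxE expr0z. Qed.

Lemma laurentD a b : X (a + b) = X a * X b.
Proof.
rewrite /laurent -big_split; apply: eq_bigr => i _ /=.
by rewrite mxE expfzDr // tofracX_neq0.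
Qed.

Lemma laurent_exponent a : X (exponent a) = tofrac 'X_[a].
Proof.
rewrite mpolyXE_id rmorph_prod; apply: eq_bigr => i _.
by rewrite rmorphXn mxE.
Qed.

Lemma laurent_neq0 w : X w != 0.
Proof.
apply/eqP => e; have := oner_neq0 K.
by rewrite -laurent0 -(subrr w) laurentD e mul0r eqxx.
Qed.

Lemma clear_denominators (ws : seq Z) : exists g : 'X_{1..n}, forall w, w \in ws ->
  exists a, exponent a = w + exponent g.
Proof.
exists [multinom (\sum_(w <- ws) `|w 0%R i|)%N | i < n] => w ws_w.
exists [multinom `|(w 0 i + (\sum_(w <- ws) `|w 0%R i|)%N%:Z)%R|%N | i < n].
apply/rowP => i; rewrite !mxE !mnmE gez0_abs //.
have : (`|w 0%R i| <= \sum_(w <- ws) `|w 0%R i|)%N.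
  by rewrite (big_rem w) //= leq_addr.
by lia.
Qed.

Definition laurent_sum (L : seq (k * Z)) : K := \sum_(q <- L) tofrac q.1%:MP * X q.2.

(** A common shift [g] makes all the exponents of [L] nonnegative. The list [ws]
allows some further exponents to be shifted by the same [g]. *)
Lemma laurent_sum_poly (L : seq (k * Z)) (ws : seq Z) : exists (g : 'X_{1..n}) (e : Z -> 'X_{1..n}),
  [/\ forall w, w \in ws -> exponent (e w) = w + exponent g,
      forall q, q \in L -> exponent (e q.2) = q.2 + exponent g &
      laurent_sum L * tofrac 'X_[g] = tofrac (\sum_(q <- L) q.1 *: 'X_[e q.2])].
Proof.
have [g gP] := clear_denominators (ws ++ map snd L).
pose e w := xget 0%MM [set a | exponent a = w + exponent g].
have eP w : w \in ws ++ map snd L -> exponent (e w) = w + exponent g.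
  by move=> /gP[a aE]; rewrite /e; case: xgetP => [_ _ //|/(_ a)].
have eL q : q \in L -> exponent (e q.2) = q.2 + exponent g.
  by move=> qL; rewrite eP // mem_cat map_f ?orbT.
exists g, e; split=> // [w ws_w|]; first by rewrite eP // mem_cat ws_w.
rewrite /laurent_sum mulr_suml rmorph_sum.
apply: eq_big_seq => q qL; rewrite /= -mul_mpolyC rmorphM -mulrA; congr (_ * _).
by rewrite -laurent_exponent -laurentD -eL // laurent_exponent.
Qed.

Lemma laurent_sum0 (L : seq (k * Z)) w : laurent_sum L = 0 ->
  \sum_(q <- L | q.2 == w) q.1 = 0.
Proof.
move=> L0; have [g [e [ew eL]]] := laurent_sum_poly L [:: w].
rewrite L0 mul0r -(rmorph0 (@tofrac P)) => /tofrac_inj/esym.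
move=> /(congr1 (mcoeff (e w))); rewrite mcoeff0 raddf_sum /= => E; rewrite -[RHS]E.
rewrite big_mkcond; apply: eq_big_seq => q qL /=.
rewrite mcoeffZ mcoeffX; suff -> : (e q.2 == e w) = (q.2 == w).
  by case: eqP => _; rewrite ?mulr1 ?mulr0.
rewrite -(inj_eq exponent_inj) eL // ew ?mem_head //.
by rewrite (inj_eq (addIr _)).
Qed.

(** After a shift of exponents the fraction becomes a polynomial [h], and leading
exponents are additive; the leading exponent of [h] is among those of its
expansion. *)
Lemma laurent_sum_deg (le : rel 'X_{1..n}) (f g : P) a b L : monomial_order le ->
  lead_exp le f a -> lead_exp le g b -> tofrac f / tofrac g = laurent_sum L ->
  exponent a - exponent b \in map snd L.
Proof.
move=> le_ord fa gb fg.
have g0 : tofrac g != 0 by rewrite tofrac_eq0 (lead_exp_neq0 gb).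
have [c [e [_ eL LE]]] := laurent_sum_poly L [::].
set h := \sum_(q <- L) q.1 *: 'X_[e q.2] in LE.
have fgh : f * 'X_[c] = g * h.
  by apply: tofrac_inj; rewrite !tofracM -LE -fg mulrA [_ * (_ / _)]mulrC divfK.
have h0 : h != 0.
  apply: contraNneq (lead_exp_neq0 fa) => h0; move: fgh; rewrite h0 mulr0 => /eqP.
  by rewrite mulf_eq0 -[_ == 0 :> P]tofrac_eq0 -[X in _ || X]tofrac_eq0 (negPf (tofracX_neq0 c)) orbF tofrac_eq0.
have [l hl] := lead_exp_exists le_ord h0.
have e1 : (a + c = b + l)%MM.
  apply: (lead_exp_unique le_ord (f := f * 'X_[c])).
    exact: lead_exp_mul (lead_expX _ _ _).
  by rewrite fgh; apply: lead_exp_mul.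
have [q qL lE] : exists2 q, q \in L & l = e q.2.
  have := proj1 hl; rewrite mcoeff_msupp raddf_sum /= => hl0.
  apply: contrapT => H; case/eqP: hl0; rewrite big_seq big1 // => q qL.
  by rewrite mcoeffZ mcoeffX; case: eqP => [ql|]; [case: H; exists q | rewrite mulr0].
have -> : exponent a - exponent b = q.2.
  apply/eqP; rewrite subr_eq -(inj_eq (addIr (exponent c))) -exponentD e1 exponentD.
  by rewrite lE eL // addrAC addrC addrA.
exact: map_f.
Qed.

End Laurent.

(** * Monomial algebras *)
Lemma big_pred1_uniq (V : zmodType) (T : eqType) (s : seq T) i (F : T -> V) :
  uniq s -> i \in s -> \sum_(j <- s | j == i) F j = F i.
Proof.
move=> su si; rewrite big_mkcond (bigD1_seq i) //= eqxx big1 ?addr0 //.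
by move=> j /negPf->.
Qed.

Section MonomialAlgebra.
Variables (k : fieldType) (n : nat) (R' : subalgClosed {mpoly k[n]}).
Local Notation P := {mpoly k[n]}.
Local Notation K := {fraction P}.
Local Notation Z := 'rV[int]_n.
Local Notation X := (@laurent k n).
Local Notation A := (subalg_ring R').
Local Notation f := (@subalg_frac k n R').
Hypothesis R'_hom : homogeneous R'.

Definition exponents : set Z := [set exponent a | a in [set a | ('X_[a] : P) \in R']].
Local Notation S := exponents.

Lemma subalg_frac_inj : injective f.
Proof. by move=> x y /tofrac_inj/val_inj. Qed.

Lemma homogeneous_msupp (r : P) a : r \in R' -> a \in msupp r -> ('X_[a] : P) \in R'.
Proof.
move=> /R'_hom/(_ a) H; rewrite mcoeff_msupp => ra.
by rewrite -['X_[a]]scale1r -(mulVf ra) -scalerA rpredZ.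
Qed.

Lemma exponents0 : S 0.
Proof. by exists 0%MM; rewrite ?exponent0 //= mpolyX0 rpred1. Qed.

Lemma exponentsD a b : S a -> S b -> S (a + b).
Proof.
move=> [a' /= aR <-] [b' /= bR <-]; exists (a' + b')%MM; last by rewrite exponentD.
by rewrite /= mpolyXD rpredM.
Qed.

Definition subalg_const (c : k) : A := insubd 0 c%:MP.
Definition subalg_mon (w : Z) : A := xget 0 [set r | f r = X w].

Lemma val_subalg_const c : val (subalg_const c) = c%:MP.
Proof.
rewrite insubdK // -topredE /= /subring_of_subalg.
by rewrite -alg_mpolyC rpredZ // rpred1.
Qed.

Lemma subalg_monE w : S w -> f (subalg_mon w) = X w.
Proof.
move=> [a /= aR <-]; rewrite /subalg_mon; case: xgetP => [//|H].
have aR' : 'X_[a] \in subring_of_subalg R' by [].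
by case: (H (exist _ 'X_[a] aR' : A)); rewrite laurent_exponent.
Qed.

Lemma val_subalg_mon a : ('X_[a] : P) \in R' -> val (subalg_mon (exponent a)) = 'X_[a].
Proof.
move=> aR; have : S (exponent a) by exists a.
by move=> /subalg_monE; rewrite laurent_exponent => /tofrac_inj.
Qed.

Lemma subalg_expansion (r : A) :
  r = \sum_(a <- msupp (val r)) subalg_const (val r)@_a * subalg_mon (exponent a).
Proof.
apply: val_inj; rewrite rmorph_sum [LHS]mpolyE; apply: eq_big_seq => a ar.
rewrite rmorphM /= val_subalg_const val_subalg_mon ?mul_mpolyC //.
exact: homogeneous_msupp (valP r) ar.
Qed.

(** Expands coefficients in the algebra into monomials, leaving coefficients in the
base field. *)
Definition flatten_expansion (s : seq (A * Z)) : seq (k * Z) :=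
  flatten [seq [seq ((val q.1)@_a, exponent a + q.2) | a <- msupp (val q.1)] | q <- s].

Lemma mem_flatten_expansion (D : set Z) s : stable S D -> (forall q, q \in s -> D q.2) ->
  forall q, q \in flatten_expansion s -> D q.2.
Proof.
move=> Dst sD q /flattenP[_ /mapP[p ps ->] /mapP[a ap ->]] /=.
apply: Dst; last exact: sD.
by exists a => //; apply: homogeneous_msupp (valP p.1) ap.
Qed.

Lemma sum_flatten_expansion (Y : lmodType A) (D : set Z) (y : Z -> Y) s :
  compatible S subalg_mon D y -> (forall q, q \in s -> D q.2) ->
  \sum_(q <- s) q.1 *: y q.2 =
  \sum_(q <- flatten_expansion s) subalg_const q.1 *: y q.2.
Proof.
move=> yc sD; rewrite big_flatten /= big_map; apply: eq_big_seq => p ps.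
rewrite big_map {1}(subalg_expansion p.1) scaler_suml; apply: eq_big_seq => a ap /=.
rewrite -scalerA yc //; last exact: sD.
by exists a => //; apply: homogeneous_msupp (valP p.1) ap.
Qed.

Lemma laurent_flatten (s : seq (A * Z)) :
  \sum_(q <- s) f q.1 * X q.2 = laurent_sum (flatten_expansion s).
Proof.
have yc : compatible S subalg_mon setT (fun w => X w : rscal f).
  by move=> w a Sw _; rewrite laurentD -(subalg_monE Sw).
rewrite /laurent_sum; have := @sum_flatten_expansion (rscal f) setT _ s yc (fun _ _ => I).
move=> E; transitivity (\sum_(q <- s) q.1 *: (X q.2 : rscal f)); first by [].
rewrite E; apply: eq_bigr => q _.
by rewrite -[_ *: _]/(tofrac (val _) * _) val_subalg_const.
Qed.

Lemma subalg_constD : {morph subalg_const : a b / a + b}.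
Proof.
by move=> a b; apply: val_inj; rewrite rmorphD /= !val_subalg_const rmorphD.
Qed.

Lemma subalg_const0 : subalg_const 0 = 0.
Proof. by apply: val_inj; rewrite val_subalg_const rmorph0. Qed.

Lemma subalg_const_sum (T : Type) (s : seq T) (Q : pred T) (c : T -> k) :
  subalg_const (\sum_(i <- s | Q i) c i) = \sum_(i <- s | Q i) subalg_const (c i).
Proof. exact: (big_morph _ subalg_constD subalg_const0). Qed.

(** After expansion over the base field, terms with the same exponent are collected,
and their coefficients add up to 0 because Laurent monomials are linearly
independent. *)
Lemma monomial_algebra_binomial : binomial_relations f S X subalg_mon.
Proof.
move=> D Y y Dst yc s sD; rewrite laurent_flatten => L0.
rewrite (sum_flatten_expansion yc sD).
set L := flatten_expansion s in L0 *.
pose W := undup (map snd L).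
have part q : q \in L -> subalg_const q.1 *: y q.2 =
    \sum_(w <- W | q.2 == w) subalg_const q.1 *: y q.2.
  move=> qL; rewrite (eq_bigl (pred1 q.2)) => [|w]; last by rewrite /= eq_sym.
  by rewrite big_pred1_uniq ?undup_uniq // mem_undup map_f.
rewrite (eq_big_seq _ part) (exchange_big_dep xpredT) //= big1 // => w _.
rewrite (eq_bigr (fun q => subalg_const q.1 *: y w)) => [|q /eqP-> //].
by rewrite -scaler_suml -subalg_const_sum laurent_sum0 // subalg_const0 scale0r.
Qed.

Lemma subalg_span (x : K) :
  x \in lspan [set (X w : rscal f) | w in S] <-> exists2 r, r \in R' & x = tofrac r.
Proof.
split=> [/lspan_family[s sS ->]|[r rR ->]].
  exists (val (\sum_(q <- s) q.1 * subalg_mon q.2)); first exact: valP.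
  rewrite -[RHS]/(f _) rmorph_sum; apply: eq_big_seq => q qs.
  by rewrite rmorphM /= subalg_monE //; apply: sS.
have rR' : r \in subring_of_subalg R' by [].
have -> : tofrac r = (exist _ r rR' : A) *: (X 0 : rscal f).
  by rewrite -[RHS]/(tofrac r * _) laurent0 mulr1.
by apply: rpredZ; apply: mem_lspan; exists 0 => //; apply: exponents0.
Qed.

Section Degrees.
Variable le : rel 'X_{1..n}.
Hypothesis le_ord : monomial_order le.

Lemma deg_span (D : set Z) (V : set K) : stable S D ->
  (forall x, V x <-> x \in lspan [set (X w : rscal f) | w in D]) -> deg_set le V = D.
Proof.
move=> Dst VD; apply/seteqP; split=> w.
  move=> [g [h [a [b [/VD/lspan_family[s sD gh] ga hb wE]]]]].
  have gh' : tofrac g / tofrac h = laurent_sum (flatten_expansion s).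
    by rewrite gh -laurent_flatten.
  have := laurent_sum_deg le_ord ga hb gh'.
  have -> : exponent a - exponent b = w by rewrite wE; apply/rowP => i; rewrite !mxE.
  by move=> /mapP[q qs ->]; apply: mem_flatten_expansion qs.
move=> Dw; have [c /(_ w (mem_head _ _))[a aE]] := clear_denominators [:: w].
exists 'X_[a], 'X_[c], a, c; split; try exact: lead_expX.
  apply/VD; have -> : tofrac 'X_[a] / tofrac 'X_[c] = X w.
    by rewrite -laurent_exponent aE laurentD laurent_exponent mulfK // tofracX_neq0.
  by apply: mem_lspan; exists w.
have -> : w = exponent a - exponent c by rewrite aE addrK.
by apply/rowP => i; rewrite !mxE.
Qed.

Lemma deg_subalg : deg_set le [set tofrac r | r in [set` R']] = S.
Proof.
apply: deg_span => [a b|x]; first exact: exponentsD.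
rewrite subalg_span; split=> [[r rR <-]|[r rR ->]]; by exists r.
Qed.

(** Leading exponents of the numerator and of the denominator of [X w] belong to
[S], and their difference is [w]. *)
Lemma in_frac_field_exponents w : in_frac_field R' (X w) ->
  exists2 s, S s & S (s + w).
Proof.
move=> [p [q [pR qR q0 wE]]].
have p0 : p != 0.
  by apply: contraNneq (laurent_neq0 k w) => p0; rewrite wE p0 rmorph0 mul0r.
have [a pa] := lead_exp_exists le_ord p0; have [b qb] := lead_exp_exists le_ord q0.
have := laurent_sum_deg le_ord pa qb (L := [:: (1, w)]).
rewrite /laurent_sum big_seq1 /= mpolyC1 tofrac1 mul1r wE inE => /(_ erefl)/eqP e.
exists (exponent b); first by exists b => //; apply: homogeneous_msupp qR (proj1 qb).
by rewrite -e addrC subrK; exists a => //; apply: homogeneous_msupp pR (proj1 pa).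
Qed.

Section Ideals.
Variables (I : submodClosed (subalg_frac_mod R')) (h : nat) (z : 'I_h -> Z).
Hypothesis z_frac : forall i, in_frac_field R' (X (z i)).
Hypothesis I_gen : I =i lspan [set x : subalg_frac_mod R' | exists i, x = X (z i)].

Definition ideal_exponents : set Z := [set a | exists i, S (a - z i)].

Lemma ideal_exponents_stable : stable S ideal_exponents.
Proof. by move=> s a Ss [i Si]; exists i; rewrite -addrA; apply: exponentsD. Qed.

Lemma ideal_exponents_span : I =i lspan [set (X a : rscal f) | a in ideal_exponents].
Proof.
move=> x; rewrite I_gen; apply/idP/idP; last first.
  apply: lspan_min => _ [a [i Si] <-]; rewrite -(subrK (z i) a) laurentD -subalg_monE //.
  by apply: (rpredZ (subalg_mon (a - z i))); apply: mem_lspan; exists i.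
by apply: lspan_le => _ [i ->]; exists (z i) => //; exists i; rewrite subrr; apply: exponents0.
Qed.

Lemma deg_ideal : deg_set le [set` I] = ideal_exponents.
Proof.
apply: deg_span => [|x]; first exact: ideal_exponents_stable.
by rewrite -ideal_exponents_span.
Qed.

Lemma ideal_exponents_group a : ideal_exponents a -> exists2 s, S s & S (s + a).
Proof.
move=> [i Si]; have [s Ss Ssz] := in_frac_field_exponents (z_frac i); exists s => //.
by rewrite -(subrK (z i) a) addrCA; apply: exponentsD.
Qed.

End Ideals.

Definition total_degree (w : Z) : int := \sum_i w 0 i.

Lemma total_degreeD a b : total_degree (a + b) = total_degree a + total_degree b.
Proof. by rewrite /total_degree -big_split; apply: eq_bigr => i _; rewrite mxE. Qed.

Lemma total_degree_gt0 s : S s -> s != 0 -> 0 < total_degree s.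
Proof.
move=> [a _ <-] a0; have -> : total_degree (exponent a) = (mdeg a)%:Z.
  rewrite mdegE /total_degree (big_morph Posz PoszD (erefl (Posz 0))).
  by apply: eq_bigr => i _; rewrite mxE.
rewrite ltz_nat lt0n mdeg_eq0; apply: contraNneq a0 => ->.
by rewrite exponent0.
Qed.

Lemma mono_ideal_coef (r : A) : (r : A^o) \in mono_ideal S subalg_mon -> (val r)@_0%MM = 0.
Proof.
move=> /asboolP[l [a [g [gX ->]]]]; rewrite !raddf_sum /= big1 // => i _ /=.
have [_ [[b /= bR <-] b0] <-] := gX i.
have /= -> := val_subalg_mon bR; rewrite rmorphM /= mcoeffX.
case: eqP => [e|]; last by rewrite mulr0.
by rewrite e exponent0 eqxx in b0.
Qed.

(** Removing the constant term leaves monomials of nonzero exponent, so the residue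
field of the monomial ideal is the base field. *)
Lemma mono_ideal_rest (r : A) :
  (r - subalg_const (val r)@_0%MM : A^o) \in mono_ideal S subalg_mon.
Proof.
have rest (s : seq 'X_{1..n}) : {subset s <= msupp (val r)} ->
    (\sum_(a <- s | a != 0%MM) subalg_const (val r)@_a * subalg_mon (exponent a) : A^o)
      \in mono_ideal S subalg_mon.
  move=> sr; rewrite big_seq_cond; apply: rpred_sum => a /andP[/sr ar a0].
  apply: (@rpredZ A A^o (mono_ideal S subalg_mon)); apply: mem_lspan.
  exists (exponent a) => //; split; last by rewrite -exponent0 (inj_eq (@exponent_inj n)).
  by exists a => //; apply: homogeneous_msupp (valP r) ar.
suff -> : r - subalg_const (val r)@_0%MM =
    \sum_(a <- msupp (val r) | a != 0%MM)
      subalg_const (val r)@_a * subalg_mon (exponent a) by apply: rest.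
apply/eqP; rewrite subr_eq {1}(subalg_expansion r); apply/eqP.
rewrite (bigID (fun a => a == 0%MM)) /= addrC; congr (_ + _).
have mon0 : subalg_mon (exponent 0%MM) = 1.
  by apply: val_inj; rewrite val_subalg_mon mpolyX0 ?rmorph1 // rpred1.
rewrite (eq_bigr (fun=> subalg_const (val r)@_0%MM)) => [|a /eqP->]; last first.
  by rewrite mon0 mulr1.
have [r0|r0] := boolP (0%MM \in msupp (val r)).
  by rewrite big_pred1_uniq ?msupp_uniq.
rewrite (memN_msupp_eq0 r0) subalg_const0 big1_eq //.
Qed.

Lemma mono_ideal_inverse (r : A) : (r : A^o) \in mono_ideal S subalg_mon \/
  exists r', (r * r' - 1 : A^o) \in mono_ideal S subalg_mon.
Proof.
have rest := mono_ideal_rest r; have [c0|c0] := eqVneq (val r)@_0%MM 0.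
  by left; move: rest; rewrite c0 subalg_const0 subr0.
right; exists (subalg_const ((val r)@_0%MM)^-1).
have -> : r * subalg_const ((val r)@_0%MM)^-1 - 1 =
    subalg_const ((val r)@_0%MM)^-1 * (r - subalg_const (val r)@_0%MM).
  rewrite mulrBr [in RHS]mulrC; congr (_ - _); apply: val_inj.
  by rewrite rmorphM rmorph1 /= !val_subalg_const -rmorphM mulVf // rmorph1.
exact: (@rpredZ A A^o (mono_ideal S subalg_mon)).
Qed.

Theorem monomial_algebra_torsion_length (F : realType)
    (I J : submodClosed (subalg_frac_mod R')) :
  monomial_fractional_ideal_of I -> monomial_fractional_ideal_of J ->
  module_length F (torsion (tensor (submod I) (submod J))) =
    tau (deg_set le [set tofrac r | r in [set` R']])
        (deg_set le [set` I]) (deg_set le [set` J]) F.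
Proof.
move=> [h [z [zf Iz]]] [h' [z' [z'f Jz]]].
rewrite deg_subalg (deg_ideal Iz) (deg_ideal Jz).
apply: (@torsion_length_monomial _ _ _ _ _ _ X subalg_mon total_degree).
- exact: subalg_frac_inj.
- exact: laurent0.
- exact: laurentD.
- exact: exponents0.
- exact: exponentsD.
- exact: subalg_monE.
- exact: total_degreeD.
- exact: total_degree_gt0.
- by apply/negP => /mono_ideal_coef/eqP; rewrite !rmorph1 oner_eq0.
- exact: mono_ideal_inverse.
- exact: monomial_algebra_binomial.
- exact: ideal_exponents_stable.
- exact: ideal_exponents_stable.
- exact: ideal_exponents_group.
- exact: ideal_exponents_span.
- exact: ideal_exponents_span.
Qed.

End Degrees.
End MonomialAlgebra.

Theorem proposition2p16 (F : realType)
    (R : idomainType) (m : idealr R) (t : {fraction R})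
    (v : {fraction R} -> int) (I J : submodClosed (frac_mod R))
    (k : fieldType) (n : nat) (R' : subalgClosed {mpoly k[n]})
    (le : rel 'X_{1..n}) (I' J' : submodClosed (subalg_frac_mod R')) :
  local_ring m ->
  krull_dim R F = 1%:E ->
  analytically_irreducible m ->
  residually_rational R ->
  normalized_valuation v (@int_closure R) ->
  int_closure t ->
  (exists e (d : 'I_e -> nat),
     [set tofrac r | r in [set` m]] =
     [set` lspan [set x : frac_mod R | exists i, x = t ^+ d i]]) ->
  monomial_fractional_ideal t I ->
  monomial_fractional_ideal t J ->
  homogeneous R' ->
  monomial_order le ->
  monomial_fractional_ideal_of I' ->
  monomial_fractional_ideal_of J' ->
  module_length F (torsion (tensor (submod I) (submod J))) =
    tau (value_set v (range (@tofrac R)))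
        (value_set v [set` I]) (value_set v [set` J]) F
  /\
  module_length F (torsion (tensor (submod I') (submod J'))) =
    tau (deg_set le [set tofrac f | f in [set` R']])
        (deg_set le [set` I']) (deg_set le [set` J']) F.
Proof.
move=> [_ [m_max _]] _ _ _ v_val _ [e [d m_gen]] It Jt R'_hom le_ord I't J't.
split; first exact: (valuation_torsion_length m_max v_val m_gen).
exact: monomial_algebra_torsion_length.
Qed.
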